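(* Let $A\equiv A(\mu):\mathcal{H}\to\mathcal{W}=\mathcal{R}(A)$, the centers $\Xi_N=\{\xi_1,\dots,\xi_N\}\subset\Omega$, and the subspaces $H_N=\mathrm{span}\{\mathfrak{K}_{\xi_1},\dots,\mathfrak{K}_{\xi_N}\}$ and $W_N=\mathrm{span}\{\mathfrak{w}_{\xi_1},\dots,\mathfrak{w}_{\xi_N}\}$ be as in the context, with $H_N\subset \mathcal{N}(A)^\perp\subset\mathcal{H}$ and $W_N\subset\mathcal{W}$ for every $N\ge N_0$. Let $b,b^\delta\in\mathcal{W}$, put $\delta=\|b-b^\delta\|_{\mathcal{W}}$, and let $v_N^\delta=G_Nb^\delta\in H_N$ be the Galerkin approximation (Method (C1)) of the noisy operator equation $Av^\delta=b^\delta$, where $G_N=(\Pi_{W_N}A|_{H_N})^{-1}\Pi_{W_N}$. Let $v\in\mathcal{H}$ be the solution of the noise-free equation $Av=b$, and assume that $v=L_{\mathfrak{K}}p$ for some $p\in L^2(\Omega)$. If the Galerkin scheme is convergent, then there exist constants $C_1,C_2>0$, independent of $N$ and of $b^\delta$ (hence of $\delta$), such that for all $N\ge N_0$ $$\begin{aligned}\|v-v_N^\delta\|_{L^\infty(\Omega)}&\le \|v-v_N^\delta\|_{\mathcal{H}}\\&\le C_1\delta+C_2\,\|L_{\mathfrak{K}}^{-1}v\|_{L^2(\Omega)}\,\sup_{\xi\in\Omega}\sqrt{\mathfrak{K}(\xi,\xi)-\mathfrak{K}_{\Xi_N}^{\mathrm T}(\xi)\mathbb{K}_N^{-1}\mathfrak{K}_{\Xi_N}(\xi)}\\&=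 C_1\delta+C_2\,\sup_{\xi\in\Omega}\mathcal{P}_{H_N}(\xi)\,\|L_{\mathfrak{K}}^{-1}v\|_{L^2(\Omega)},\end{aligned}$$ where $L_{\mathfrak{K}}^{-1}v$ denotes $p$.
   Context: Domain and kernel. $\Omega\subset\mathbb{R}^n$ is compact, simply connected, and equal to the closure of its interior. $\mathfrak{K}:\Omega\times\Omega\to\mathbb{R}$ is a symmetric, strictly positive kernel (Gram matrices of finitely many distinct points are positive definite), bounded on the diagonal, with $\mathfrak{K}\in C^{2s}(\Omega\times\Omega)$ for some integer $s\ge1$ (derivatives on $\Omega$ are continuous extensions from the interior). $\mathcal{H}$ is the reproducing kernel Hilbert space (RKHS) of real-valued functions on $\Omega$ with kernel $\mathfrak{K}$; $\mathfrak{K}_x=\mathfrak{K}(\cdot,x)$. Functions in $\mathcal{H}$ are $C^s$, and $D^{e_k}v(x)=(D^{(e_k,0)}\mathfrak{K}(x,\cdot),v)_{\mathcal{H}}$, where $e_k$ is the $k$-th unit multiindex and $D^{(\alpha,\beta)}\mathfrak{K}(x,y)$ denotes differentiation of order $\alpha$ in $x$ and $\beta$ in $y$. Operator. $f:\mathbb{R}^n\to\mathbb{R}^n$ and $g:\mathbb{R}^n\to\mathbb{R}^{n\times m}$ are given (dynamics $\dot x=f(x)+g(x)u$), and $\mu:\Omega\to\mathbb{R}^m$ is a fixed feedback law. For $v\in\mathcal{H}$, $$(Av)(x)=(f(x)+g(x)\mu(x))^{\mathrm T}\nabla v(x)=\sum_{k=1}^n a_k(x)D^{e_k}v(x),\qquad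 a_k=f_k+\sum_{j=1}^m g_{kj}\mu_j.$$ $\mathcal{N}(A)$ and $\mathcal{R}(A)$ are the nullspace and range. $\mathcal{W}=\mathcal{R}(A)$ is normed by $\|w\|_{\mathcal{W}}=\inf\{\|h\|_{\mathcal{H}}: Ah=w\}$; it is the RKHS with kernel $$\mathfrak{w}(x,y)=\sum_{k,\ell=1}^n a_k(x)\,D^{(e_k,e_\ell)}\mathfrak{K}(x,y)\,a_\ell(y),$$ and $\mathfrak{w}_\xi=\mathfrak{w}(\cdot,\xi)$. Galerkin scheme. For each $N\ge N_0$, $\Xi_N=\{\xi_1,\dots,\xi_N\}\subset\Omega$ is a set of $N$ distinct centers. $\Pi_{W_N}$ is the $\mathcal{W}$-orthogonal projection onto $W_N$, and $G_N=(\Pi_{W_N}A|_{H_N})^{-1}\Pi_{W_N}:\mathcal{W}\to H_N$. The scheme is convergent if $G_N$ is well-defined for every $N\ge N_0$ and, for every $y\in\mathcal{R}(A)$, $G_Ny\to (A|_{\mathcal{N}(A)^\perp})^{-1}y$ in $\mathcal{H}$ as $N\to\infty$. Other notation. $(L_{\mathfrak{K}}p)(x)=\int_\Omega\mathfrak{K}(x,y)p(y)\,dy$ for $p\in L^2(\Omega)$. $\mathfrak{K}_{\Xi_N}(x)=[\mathfrak{K}_{\xi_1}(x),\dots,\mathfrak{K}_{\xi_N}(x)]^{\mathrm T}\in\mathbb{R}^N$, $\mathbb{K}_N=[\mathfrak{K}(\xi_i,\xi_j)]\in\mathbb{R}^{N\times N}$, and the power function of $H_N$ in $\mathcal{H}$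 is $\mathcal{P}_{H_N}(x)=\sqrt{\mathfrak{K}(x,x)-\mathfrak{K}_{\Xi_N}^{\mathrm T}(x)\mathbb{K}_N^{-1}\mathfrak{K}_{\Xi_N}(x)}$.
   Formalization: The first inequality is proved as ‖v−v_N^δ‖_{L^∞} ≤ κ‖v−v_N^δ‖_H with κ = sup_x √K(x,x), since with constant 1 it fails when K(x,x)>1; the bound of the L^∞ norm by the right-hand side is kept with the same C1, C2. *)

(* Defs.v *)
(* R^n is 'rV[R]_n over a realType R, and a real function on
   Omega is a function on R^n whose values outside Omega are irrelevant (or set
   to 0 when functions on Omega are compared by equality, see [_ \_ Omega]). *)
From HB Require Import structures.
From mathcomp Require Import all_boot all_order all_algebra.
From mathcomp Require Import all_classical all_reals all_analysis.
From mathcomp Require Import sesquilinear.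

Set Implicit Arguments.
Unset Strict Implicit.
Unset Printing Implicit Defensive.

Import Order.TTheory GRing.Theory Num.Theory.
Import numFieldNormedType.Exports.

Local Open Scope classical_set_scope.
Local Open Scope ring_scope.

Definition rV_display : measure_display.
Proof. exact: default_measure_display. Qed.

Section measurable_rV.
Context (R : realType) (n : nat).

Definition rV_coord (i : 'I_n) (x : 'rV[R]_n) : measurableTypeR R := x 0 i.

Let rV_set0 : g_sigma_preimage rV_coord set0.
Proof. exact: sigma_algebra0. Qed.

Let rV_setC A : g_sigma_preimage rV_coord A -> g_sigma_preimage rV_coord (~` A).
Proof. exact: sigma_algebraC. Qed.

Let rV_bigcup (F : _^nat) : (forall i, g_sigma_preimage rV_coord (F i)) ->
  g_sigma_preimage rV_coord (\bigcup_i (F i)).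
Proof. exact: sigma_algebra_bigcup. Qed.

(* The product sigma-algebra, i.e. the Borel sigma-algebra of R^n. *)
HB.instance Definition _ := @isMeasurable.Build rV_display
  'rV[R]_n (g_sigma_preimage rV_coord) rV_set0 rV_setC rV_bigcup.

Lemma measurable_rV_coord i : measurable_fun setT (rV_coord i).
Proof.
move=> _ Y mY; rewrite setTI; apply: sub_sigma_algebra => /=.
rewrite -bigcup_seq/=; exists i => /=; first by rewrite mem_index_enum.
by exists Y => //; rewrite setTI.
Qed.

Lemma measurable_fun_rV d (T : measurableType d) (f : T -> 'rV[R]_n) :
  (forall i, measurable_fun setT (rV_coord i \o f)) -> measurable_fun setT f.
Proof.
move=> mf; apply: (@measurability _ _ _ _ _ f
  (\big[setU/set0]_(i < n) preimage_set_system setT (rV_coord i) measurable)).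
  by [].
move=> _ [B + <-]; rewrite -bigcup_seq => -[i _ [C mC <-]].
by rewrite setTI; exact: mf.
Qed.

End measurable_rV.

Section lebesgue_rV.
Context (R : realType).

Definition rV_cons n (z : measurableTypeR R * 'rV[R]_n) : 'rV[R]_n.+1 :=
  row_mx (const_mx z.1 : 'rV[R]_1) z.2.

Definition rV_uncons n (x : 'rV[R]_n.+1) : measurableTypeR R * 'rV[R]_n :=
  (x 0 0, rsubmx (x : 'rV[R]_(1 + n))).

Lemma rV_consK n : cancel (@rV_cons n) (@rV_uncons n).
Proof.
move=> [a x]; rewrite /rV_uncons /rV_cons row_mxKr; congr (_, _).
rewrite mxE; case: splitP => [j _|k] /=; first by rewrite mxE.
by move/eqP; rewrite eq_sym.
Qed.

Lemma measurable_rV_cons n : measurable_fun setT (@rV_cons n).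
Proof.
apply: measurable_fun_rV => i.
rewrite (_ : _ \o _ = fun z => row_mx (const_mx z.1 : 'rV[R]_1) z.2 0 i)//.
under eq_fun do rewrite mxE.
case: (splitP (i : 'I_(1 + n))) => [j _|k _].
  by under eq_fun do rewrite mxE; exact: measurable_fst.
exact: (measurableT_comp (measurable_rV_coord k) measurable_snd).
Qed.

Lemma measurable_rV_uncons n : measurable_fun setT (@rV_uncons n).
Proof.
apply/measurable_fun_pairP; split; first exact: (measurable_rV_coord 0).
apply: measurable_fun_rV => i.
rewrite (_ : _ \o _ = rV_coord (rshift 1 i)); first exact: measurable_rV_coord.
by apply/funext => x; rewrite /= /rV_coord mxE.
Qed.

Section step.
Context (n : nat) (mu : {sigma_finite_measure set 'rV[R]_n -> \bar R}).

Definition lebesgue_rV_step : set 'rV[R]_n.+1 -> \bar R :=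
  pushforward (lebesgue_measure \x mu)%E (@rV_cons n).

Let step_measure : {measure set 'rV[R]_n.+1 -> \bar R} :=
  measure_function_pushforward__canonical__measure_function_Measure
    (lebesgue_measure \x mu)%E (measurable_rV_cons (n := n)).

HB.instance Definition _ := isMeasure.Build _ _ _ lebesgue_rV_step
  (measure0 step_measure) (measure_ge0 step_measure)
  (@measure_semi_sigma_additive _ _ _ step_measure).

Let step_sigma_finite : sigma_finite setT lebesgue_rV_step.
Proof.
have /sigma_finiteP[F [TF ndF Foo]] := sigma_finiteT (@lebesgue_measure R).
have /sigma_finiteP[G [TG ndG Goo]] := sigma_finiteT mu.
exists (fun k => (@rV_uncons n) @^-1` (F k `*` G k)).
  rewrite -preimage_bigcup [X in _ @^-1` X](_ : _ = setT) ?preimage_setT//.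
  apply/seteqP; split => // -[x y] _.
  have [k _ Fx] : (\bigcup_k F k) x by rewrite -TF.
  have [l _ Gy] : (\bigcup_k G k) y by rewrite -TG.
  exists (maxn k l) => //; split => /=.
    by move: x Fx; exact/subsetPset/ndF/leq_maxl.
  by move: y Gy; exact/subsetPset/ndG/leq_maxr.
move=> k; have [mF Fk] := Foo k; have [mG Gk] := Goo k; split.
  by rewrite -[X in measurable X]setTI; apply: measurable_rV_uncons => //;
     exact: measurableX.
rewrite /lebesgue_rV_step /pushforward -comp_preimage.
rewrite (_ : _ \o _ = id); last by apply/funext => z; exact: rV_consK.
by rewrite preimage_id product_measure1E// lte_mul_pinfty// ge0_fin_numE.
Qed.

HB.instance Definition _ := Measure_isSigmaFinite.Build _ _ _ lebesgue_rV_step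
  step_sigma_finite.

End step.

Fixpoint lebesgue_rV n : {sigma_finite_measure set 'rV[R]_n -> \bar R} :=
  match n with
  | 0 => dirac (0 : 'rV[R]_0)
  | n'.+1 => lebesgue_rV_step (lebesgue_rV n')
  end.

Lemma lebesgue_rV_box n (A : 'I_n -> set (measurableTypeR R)) :
  (forall i, measurable (A i)) ->
  lebesgue_rV n [set x | forall i, A i (x 0 i)] =
  (\prod_(i < n) lebesgue_measure (A i))%E.
Proof.
elim: n A => [|n IH] A mA.
  rewrite big_ord0 /= diracE mem_set//= => -[].
  by [].
have consS (a : measurableTypeR R) (x : 'rV[R]_n) j :
    rV_cons (a, x) 0 (lift ord0 j) = x 0 j.
  have -> : lift ord0 j = rshift 1 j :> 'I_(1 + n) by apply/val_inj.
  exact: row_mxEr.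
have cons0 (a : measurableTypeR R) (x : 'rV[R]_n) : rV_cons (a, x) 0 ord0 = a.
  exact: (congr1 fst (rV_consK (a, x))).
have AE : (@rV_cons n) @^-1` [set x | forall i, A i (x 0 i)] =
    A ord0 `*` [set x : 'rV[R]_n | forall i, A (lift ord0 i) (x 0 i)].
  apply/seteqP; split => -[a x] /=.
    move=> H; split => [|i]; first by rewrite -(cons0 a x).
    by rewrite -(consS a x i).
  move=> [Aa Ax] i; case: (unliftP ord0 i) => [j|] ->; first by rewrite consS.
  by rewrite cons0.
have mB : measurable [set x : 'rV[R]_n | forall i, A (lift ord0 i) (x 0 i)].
  rewrite (_ : mkset _ = \big[setI/setT]_(i < n)
      ((@rV_coord R n i) @^-1` A (lift ord0 i))).
    apply: bigsetI_measurable => i _; rewrite -[X in measurable X]setTI.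
    exact: measurable_rV_coord.
  apply/seteqP; split => x /=; rewrite -bigcap_seq /=.
    by move=> Ax i _; exact: Ax.
  by move=> Ax i; apply: (Ax i); rewrite /= mem_index_enum.
rewrite big_ord_recl -IH// -product_measure1E// -AE.
by [].
Qed.

End lebesgue_rV.

Section domain.
Context (R : realType) (n : nat).
Local Notation V := 'rV[R]_n.
Implicit Type Omega : set V.

Definition path_connected Omega := forall x y, Omega x -> Omega y ->
  exists gamma : R -> V, [/\ {within `[0, 1], continuous gamma},
    gamma @` `[0, 1] `<=` Omega, gamma 0 = x & gamma 1 = y].

(* The homotopy [F] is based: F 0 = gamma, F 1 is constant, and the base point
   gamma 0 = gamma 1 does not move. *)
Definition loops_contractible Omega := forall gamma : R -> V,
  {within `[0, 1], continuous gamma} -> gamma @` `[0, 1] `<=` Omega ->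
  gamma 0 = gamma 1 ->
  exists F : R * R -> V,
    [/\ {within `[0, 1] `*` `[0, 1], continuous F},
        F @` (`[0, 1] `*` `[0, 1]) `<=` Omega,
        (forall t, 0 <= t <= 1 -> F (0, t) = gamma t /\ F (1, t) = gamma 0) &
        (forall r, 0 <= r <= 1 -> F (r, 0) = gamma 0 /\ F (r, 1) = gamma 0)].

Definition simply_connected Omega :=
  path_connected Omega /\ loops_contractible Omega.

End domain.

Section derivatives.
Context (R : realType) (n : nat).
Local Notation V := 'rV[R]_n.
Implicit Types (Omega : set V) (h : V -> R) (l : seq 'I_n).

Definition unit_vec (k : 'I_n) : V := delta_mx 0 k.

(* pderiv [:: k1; ...; kr] h is d/dx_k1 ... d/dx_kr h. *)
Definition pderiv l h : V -> R :=
  foldr (fun k (u : V -> R) => fun x => 'D_(unit_vec k) u x) h l.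

(* C^r(Omega): r times continuously differentiable in the interior, every
   partial derivative of order at most r extending continuously to Omega. *)
Definition Ck_on (r : nat) Omega h :=
  [/\ {within Omega, continuous h},
      (forall l k x, (size l < r)%N -> Omega° x ->
         derivable (pderiv l h) x (unit_vec k)) &
      (forall l, (size l <= r)%N -> exists F : V -> R,
         {within Omega, continuous F} /\
         (forall x, Omega° x -> F x = pderiv l h x))].

(* The derivative on Omega: the limit from the interior. *)
Definition bderiv Omega l h (x : V) : R :=
  lim (pderiv l h y @[y --> within Omega° (nbhs x)]).

End derivatives.

Section kernels.
Context (R : realType) (n : nat).
Local Notation V := 'rV[R]_n.
Implicit Types (Omega : set V) (K : V -> V -> R).

Definition sqdom Omega : set 'rV[R]_(n + n) :=
  [set z | Omega (lsubmx z) /\ Omega (rsubmx z)].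

Definition uncurry_rV K (z : 'rV[R]_(n + n)) : R := K (lsubmx z) (rsubmx z).

Definition symmetric_on Omega K :=
  forall x y, Omega x -> Omega y -> K x y = K y x.

Definition gram K N (x : 'I_N -> V) : 'M[R]_N := \matrix_(i, j) K (x i) (x j).

Definition strictly_positive_on Omega K :=
  forall N (x : 'I_N -> V), (forall i, Omega (x i)) -> injective x ->
  forall c : 'cV[R]_N, c != 0 -> 0 < (c^T *m gram K x *m c) 0 0.

Definition diag_bounded_on Omega K :=
  exists M : R, forall x, Omega x -> K x x <= M.

(* [dK Omega K k l x y] is D^{(e_k, e_l)} K (x, y). *)
Definition dK Omega K (k l : 'I_n) (x y : V) : R :=
  bderiv (sqdom Omega) [:: lshift n k; rshift n l] (uncurry_rV K) (row_mx x y).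

(* The kernel section K_x as a column over the centers, and the power function
   of the span of the K_(xi i). *)
Definition kvec K N (xi : 'I_N -> V) (x : V) : 'cV[R]_N := \col_i K x (xi i).

Definition power_fun K N (xi : 'I_N -> V) (x : V) : R :=
  Num.sqrt (K x x - ((kvec K xi x)^T *m invmx (gram K xi) *m kvec K xi x) 0 0).

(* A realization of the reproducing kernel Hilbert space of real functions on
   Omega with kernel K, which is unique up to isometry: a Hilbert space together
   with the injection [rkhs_fun] of its elements into functions on Omega. *)
Record rkhs Omega K := Rkhs {
  rkhs_space :> completeNormedModType R;
  rkhs_ip : {dot rkhs_space for idfun};
  rkhs_norm : forall h, `|h| ^+ 2 = rkhs_ip h h;
  rkhs_fun : rkhs_space -> V -> R;
  rkhs_fun_linear : forall a h h' x, Omega x ->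
    rkhs_fun (a *: h + h') x = a * rkhs_fun h x + rkhs_fun h' x;
  rkhs_fun_inj : forall h h',
    (forall x, Omega x -> rkhs_fun h x = rkhs_fun h' x) -> h = h';
  rkhs_ker : V -> rkhs_space;
  rkhs_kerE : forall x y, Omega x -> Omega y -> rkhs_fun (rkhs_ker x) y = K y x;
  rkhs_reproducing : forall h x, Omega x ->
    rkhs_ip h (rkhs_ker x) = rkhs_fun h x
}.

End kernels.

Definition lspan (R : realType) (E : lmodType R) N (u : 'I_N -> E) : set E :=
  [set \sum_(i < N) c i *: u i | c in [set: 'I_N -> R]].

Section galerkin.
Context (R : realType) (n m : nat).
Local Notation V := 'rV[R]_n.
Context (Omega : set V) (K : V -> V -> R) (H : rkhs Omega K).
Context (f : V -> V) (g : V -> 'M[R]_(n, m)) (mu : V -> 'rV[R]_m).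

Definition coef (k : 'I_n) (x : V) : R :=
  f x 0 k + \sum_(j < m) g x k j * mu x 0 j.

(* (A h)(x) = (f(x) + g(x) mu(x))^T grad h(x).  Elements of W = R(A) are functions
   on Omega, extended by 0. *)
Definition opA (h : H) : V -> R :=
  (fun x => \sum_(k < n) coef k x * bderiv Omega [:: k] (rkhs_fun h) x) \_ Omega.

Definition rangeA : set (V -> R) := range opA.

Definition orthN : set H :=
  [set h | forall z, opA z = 0 -> rkhs_ip H h z = 0].

Definition normW (w : V -> R) : R := inf [set `|h| | h in [set h : H | opA h = w]].

(* [normW] is a Hilbert norm; its inner product, by polarization. *)
Definition ipW (w w' : V -> R) : R :=
  (normW (w + w') ^+ 2 - normW (w - w') ^+ 2) / 4.

Definition wker (x y : V) : R :=
  \sum_(k < n) \sum_(l < n) coef k x * dK Omega K k l x y * coef l y.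

Definition wsec (y : V) : V -> R := (wker^~ y) \_ Omega.

Definition projW (S : set (V -> R)) (w : V -> R) : V -> R :=
  get [set u | S u /\ forall z, S z -> ipW (w - u) z = 0].

Section scheme.
Context (N : nat) (xi : 'I_N -> V).

Definition HN : set H := lspan (fun i => rkhs_ker H (xi i)).
Definition WN : set (V -> R) := lspan (fun i => wsec (xi i)).

(* The restriction to HN of Pi_WN A; G_N is its inverse HN <- WN composed with
   Pi_WN. *)
Definition galerkin_op (h : H) : V -> R := projW WN (opA h).

Definition galerkin_well_defined := set_bij HN WN galerkin_op.

Definition galerkin (w : V -> R) : H :=
  'pinv_(fun=> 0) HN galerkin_op (projW WN w).

End scheme.

Definition galerkin_convergent (N0 : nat) (xi : forall N, 'I_N -> V) :=
  (forall N, (N0 <= N)%N -> galerkin_well_defined (xi N)) /\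
  (forall w, rangeA w ->
     galerkin (xi N) w @[N --> \oo] --> 'pinv_(fun=> 0) orthN opA w).

End galerkin.

Arguments HN {R n Omega K} H {N} xi.

Section integral_norms.
Context (R : realType) (n : nat) (Omega : set 'rV[R]_n).
Implicit Types p h : 'rV[R]_n -> R.
Local Notation leb := (@lebesgue_rV R n).

(* Norms over Omega are taken on R^n after extension by 0, which changes neither
   the integral of |p|^2 nor the essential supremum of |h|. *)
Definition in_L2 p := p \_ Omega \in Lfun leb 2%:E.

Definition normL2 p : R := fine ('N[leb]_2%:E[EFin \o p \_ Omega])%E.

Definition normLoo h : \bar R := ('N[leb]_+oo[EFin \o h \_ Omega])%E.

Definition LK (K : 'rV[R]_n -> 'rV[R]_n -> R) p (x : 'rV[R]_n) : R :=
  \int[leb]_(y in Omega) (K x y * p y).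

End integral_norms.

(* Main.v *)
(* Put T_N h = G_N (A h).  Since |.|_W is the quotient norm of H by ker A, the
   W-inner product of A h and A h' is the H-inner product of the projections of
   h and h' on (ker A)^perp, so T_N h is the element of H_N whose image differs
   from A h by something W-orthogonal to W_N.  Hence T_N is linear, bounded and
   the identity on H_N, and convergence of the scheme together with the
   Banach-Steinhaus theorem bounds |T_N| by some M for all N >= N0.  As
   |G_N (b - b^delta)| <= M |h| for every h with A h = b - b^delta, taking the
   infimum over h gives the term in delta.  For the other term,
   v - T_N v = (1 - T_N) (v - Pi v) with Pi the projection on H_N, and
   e = v - Pi v satisfies |e|^2 = (v, e) = \int_Omega p e
   <= |p|_2 |Omega|^(1/2) |e| sup P_{H_N}.
   Linearity of A requires the derivatives of functions in H to exist and to
   extend to the boundary, which holds because the difference quotients of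
   x |-> K_x are Cauchy in H as soon as K is of class C^2. *)
Require Import Defs.
From HB Require Import structures.
From mathcomp Require Import all_boot all_order all_algebra.
From mathcomp Require Import all_classical all_reals all_analysis.
From mathcomp Require Import sesquilinear.
From mathcomp Require Import measurable_realfun ess_sup_inf ring lra.

Set Implicit Arguments.
Unset Strict Implicit.
Unset Printing Implicit Defensive.

Import Order.TTheory GRing.Theory Num.Theory.
Import numFieldNormedType.Exports.

Local Open Scope classical_set_scope.
Local Open Scope ring_scope.

(** * Hilbert spaces *)

Section hilbert.
Context (R : realType) (E : completeNormedModType R) (ip : {dot E for idfun}).
Hypothesis normE : forall h, `|h| ^+ 2 = ip h h.
Implicit Types (h u v z : E) (N : set E).

Lemma ipC u v : ip u v = ip v u.
Proof. by rewrite [LHS]hermC expr0 mul1r. Qed.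

Lemma ipDl u v z : ip (u + v) z = ip u z + ip v z.
Proof. exact: linearDl. Qed.

Lemma ipBl u v z : ip (u - v) z = ip u z - ip v z.
Proof. exact: linearBl. Qed.

Lemma ipZl a u z : ip (a *: u) z = a * ip u z.
Proof. exact: linearZl_LR. Qed.

Lemma ipDr u v z : ip z (u + v) = ip z u + ip z v.
Proof. exact: linearDr. Qed.

Lemma ipBr u v z : ip z (u - v) = ip z u - ip z v.
Proof. exact: linearBr. Qed.

Lemma ipZr a u z : ip z (a *: u) = a * ip z u.
Proof. by rewrite ipC ipZl ipC. Qed.

Lemma ip0l u : ip 0 u = 0.
Proof. exact: linear0l. Qed.

Lemma ip_suml I (r : seq I) (P : pred I) (F : I -> E) u :
  ip (\sum_(i <- r | P i) F i) u = \sum_(i <- r | P i) ip (F i) u.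
Proof. exact: linear_sumlz. Qed.

Lemma ip_eq0 u : ip u u = 0 -> u = 0.
Proof. by rewrite -normE => /eqP; rewrite sqrf_eq0 normr_eq0 => /eqP. Qed.

Lemma ip_subZ u v t :
  ip (u - t *: v) (u - t *: v) = ip u u - t * ip u v *+ 2 + t ^+ 2 * ip v v.
Proof. by rewrite !ipBl !ipBr !ipZl !ipZr (ipC v u); ring. Qed.

Lemma polarization u v : (`|u + v| ^+ 2 - `|u - v| ^+ 2) / 4 = ip u v.
Proof.
rewrite !normE.
have -> : ip (u + v) (u + v) = ip u u + ip u v *+ 2 + ip v v.
  by rewrite ipDl !ipDr (ipC v u); ring.
have := ip_subZ u v 1; rewrite scale1r mul1r expr1n mul1r => ->.
by field.
Qed.

Lemma cauchy_schwarz u v : `|ip u v| <= `|u| * `|v|.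
Proof.
have [->|v0] := eqVneq v 0; first by rewrite ipC ip0l !normr0 mulr0.
have vv : 0 < ip v v by rewrite -normE exprn_gt0// normr_gt0.
rewrite -(@ler_pXn2r _ 2)// ?nnegrE ?mulr_ge0//.
rewrite exprMn !normE real_normK ?num_real//.
have : 0 <= ip (u - (ip u v / ip v v) *: v) (u - (ip u v / ip v v) *: v).
  by rewrite -normE exprn_ge0.
rewrite ip_subZ.
rewrite [X in 0 <= X -> _](_ : _ = ip u u - ip u v ^+ 2 / ip v v); last first.
  by field; rewrite gt_eqF.
by rewrite subr_ge0 ler_pdivrMr.
Qed.

(** * Orthogonal decomposition along a subspace that need not be closed *)

Definition linear_subset N := N 0 /\ forall a u v, N u -> N v -> N (a *: u + v).

Definition adherent N y := forall e, 0 < e -> exists2 n, N n & `|y - n| < e.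

Lemma orth_proj_exists N h : linear_subset N ->
  exists2 z, adherent N (h - z) & forall n, N n -> ip z n = 0.
Proof.
move=> [N0 NP].
pose S := [set `|h - n| ^+ 2 | n in N].
have S0 : S !=set0 by exists (`|h - 0| ^+ 2), 0.
have Slb : lbound S 0 by move=> _ [n _ <-]; rewrite exprn_ge0.
have hS : has_inf S by split=> //; exists 0.
pose d := inf S.
have dle n : N n -> d <= `|h - n| ^+ 2.
  by move=> Nn; apply: ge_inf; [exists 0|exists n].
have /choice[n nP] (k : nat) :
    exists n, N n /\ `|h - n| ^+ 2 < d + k.+1%:R^-1.
  have k0 : 0 < k.+1%:R^-1 :> R by rewrite invr_gt0.
  have [_ [n Nn <-] lt] := inf_adherent k0 hS.
  by exists n.
have small k x : N x -> ip (h - n k) x ^+ 2 <= k.+1%:R^-1 * ip x x.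
  move=> Nx; have [Nn lt] := nP k.
  have [->|x0] := eqVneq x 0.
    by rewrite ipC !ip0l expr2 !mulr0.
  have xx : 0 < ip x x by rewrite -normE exprn_gt0// normr_gt0.
  pose t := ip (h - n k) x / ip x x.
  have /dle : N (t *: x + n k) by exact: NP.
  rewrite (_ : h - _ = (h - n k) - t *: x); last by rewrite opprD addrA addrAC.
  move: lt; rewrite !normE ip_subZ => lt le.
  rewrite -ler_pdivrMr//.
  suff : t * ip (h - n k) x *+ 2 - t ^+ 2 * ip x x =
    ip (h - n k) x ^+ 2 / ip x x.
    have arith (a b c e q : R) : a < c + e -> c <= a - b + q -> b - q <= e.
      by lra.
    by move=> <-; exact: arith lt le.
  by rewrite /t; field; rewrite gt_eqF.
(* Almost-orthogonality is applied to [x = n k - n l], which is also [(h - n l) - (h - n k)]; after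
   division by [|n k - n l|] this is the Cauchy estimate. *)
have cN k l : `|n k - n l| ^+ 2 <=
    (Num.sqrt k.+1%:R^-1 + Num.sqrt l.+1%:R^-1) * `|n k - n l|.
  have Nkl : N (n k - n l).
    by rewrite addrC -scaleN1r; apply: NP; [exact: (nP l).1|exact: (nP k).1].
  have small' i : `|ip (h - n i) (n k - n l)| <=
      Num.sqrt i.+1%:R^-1 * `|n k - n l|.
    rewrite -(@ler_pXn2r _ 2)// ?nnegrE ?mulr_ge0 ?sqrtr_ge0//.
    rewrite exprMn sqr_sqrtr ?invr_ge0// normE real_normK ?num_real//.
    exact: small.
  rewrite normE [X in ip X _ <= _](_ : _ = (h - n l) - (h - n k)); last first.
    by rewrite opprB [RHS]addrC addrA subrK.
  rewrite ipBl mulrDl; have := small' k; have := small' l.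
  rewrite !ler_norml => /andP[? ?] /andP[? ?]; lra.
have sq0 : (Num.sqrt k.+1%:R^-1 : R) @[k --> \oo] --> (0:R).
  rewrite -[X in _ --> X](@sqrtr0 R).
  by apply: continuous_cvg; [exact: sqrt_continuous|exact: cvg_harmonic].
have [m cvn] : exists m : E, n @ \oo --> m.
  suff /cauchy_exP/cauchy_cvg/cvg_ex : cauchy_ex (n @ \oo) by [].
  move=> e e0.
  have e2 : 0 < e / 2 by rewrite divr_gt0.
  have [k _ kP] : \forall k \near \oo, Num.sqrt k.+1%:R^-1 < e / 2.
    exact: (cvgr_lt 0).
  exists (n k); exists k => // l /= kl.
  rewrite -ball_normE /=.
  have [/eqP E0|ne0] := boolP (`|n k - n l| == 0); first by rewrite E0.
  have := cN k l; rewrite expr2 ler_pM2r ?lt0r ?ne0 ?normr_ge0//.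
  by have := kP k (leqnn k); have := kP l kl => /=; lra.
exists (h - m).
  rewrite opprB addrC subrK => e e0.
  have [k _ kP] := (cvgrPdist_lt _ _).1 cvn e e0.
  by exists (n k); [exact: (nP k).1|exact: (kP k (leqnn k))].
move=> x Nx.
have c1 : ip (h - n k) x @[k --> \oo] --> (0:R).
  apply/cvgr0Pnorm_le => e e0.
  have : Num.sqrt k.+1%:R^-1 * `|x| @[k --> \oo] --> 0 * `|x|.
    by apply: cvgMl.
  rewrite mul0r => cx.
  apply: filterS (cvgr_le _ cx e e0) => k /(le_trans _); apply.
  rewrite -(@ler_pXn2r _ 2)// ?nnegrE ?mulr_ge0 ?sqrtr_ge0//.
  rewrite exprMn sqr_sqrtr ?invr_ge0// normE real_normK ?num_real//.
  exact: small.
have c2 : ip (h - n k) x @[k --> \oo] --> ip (h - m) x.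
  apply/cvgrPdist_le => e e0.
  have : `|m - n k| * `|x| @[k --> \oo] --> `|m - m| * `|x|.
    apply: cvgMl; apply: cvg_norm; apply: cvgB => //; exact: cvg_cst.
  rewrite subrr normr0 mul0r => cx.
  apply: filterS (cvgr_le _ cx e e0) => k /(le_trans _); apply.
  by rewrite -ipBl opprB [h - m + _]addrC addrA subrK distrC cauchy_schwarz.
exact: (cvg_unique _ c2 c1).
Qed.

Lemma orth_adherent N z y :
  (forall n, N n -> ip z n = 0) -> adherent N y -> ip z y = 0.
Proof.
move=> zN Ny; apply/eqP; rewrite -normr_le0.
apply/ler_addgt0Pr => e e0; rewrite add0r.
have z1 : 0 < `|z| + 1 by rewrite ltr_wpDl.
have [n Nn yn] := Ny _ (divr_gt0 e0 z1).
rewrite (_ : ip z y = ip z (y - n)); last by rewrite ipBr (zN n)// subr0.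
rewrite (le_trans (cauchy_schwarz _ _))//.
rewrite (le_trans (ler_wpM2l _ (ltW yn)))//.
by rewrite mulrCA ler_piMr ?ltW// ltr_pdivrMr// mul1r ltrDl.
Qed.

Lemma adherent_lin N a x y : linear_subset N -> adherent N x -> adherent N y ->
  adherent N (a *: x + y).
Proof.
move=> [_ NP] Nx Ny e e0.
have e2 : 0 < e / 2 by rewrite divr_gt0.
have a1 : 0 < `|a| + 1 by rewrite ltr_wpDl.
have [n Nn xn] := Nx _ (divr_gt0 e2 a1).
have [k Nk yk] := Ny _ e2.
exists (a *: n + k); first exact: NP.
rewrite opprD addrACA -scalerBr (le_lt_trans (ler_normD _ _))//.
rewrite [ltRHS](splitr e) ler_ltD// normrZ.
rewrite (le_trans (ler_wpM2l _ (ltW xn)))//.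
by rewrite mulrCA ler_piMr ?(ltW e2)// ler_pdivrMr// mul1r lerDl.
Qed.

(** This is the component of [h] orthogonal to [N], not the one along [N]: the remainder
    [h - orth_proj N h] lies in the closure of [N]. *)
Definition orth_proj N h : E :=
  xget 0 [set z | adherent N (h - z) /\ forall n, N n -> ip z n = 0].

Section orth_proj_theory.
Variables (N : set E) (Nsub : linear_subset N).

Lemma orth_projP h : adherent N (h - orth_proj N h) /\
  forall n, N n -> ip (orth_proj N h) n = 0.
Proof.
have [z z1 z2] := orth_proj_exists h Nsub.
by rewrite /orth_proj; case: xgetP => [w _ //|/(_ z)[]].
Qed.

(** The difference of two candidates is orthogonal to [N] and lies in its closure, hence is
    orthogonal to itself. *)
Lemma orth_proj_unique h z : adherent N (h - z) ->
  (forall n, N n -> ip z n = 0) -> z = orth_proj N h.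
Proof.
move=> hz zN; have [hp pN] := orth_projP h.
apply/eqP; rewrite -subr_eq0; apply/eqP/ip_eq0/(@orth_adherent N).
  by move=> n Nn; rewrite ipBl zN// pN// subrr.
have := adherent_lin (-1) Nsub hz hp.
by rewrite scaleN1r opprB addrA subrK.
Qed.

Lemma orth_proj_lin a h h' :
  orth_proj N (a *: h + h') = a *: orth_proj N h + orth_proj N h'.
Proof.
have [hp pN] := orth_projP h; have [hp' pN'] := orth_projP h'.
apply/esym/orth_proj_unique.
  by rewrite opprD addrACA -scalerBr; exact: adherent_lin.
by move=> n Nn; rewrite ipDl ipZl pN// pN'// mulr0 addr0.
Qed.

Lemma ip_orth_proj h :
  ip h (orth_proj N h) = ip (orth_proj N h) (orth_proj N h).
Proof.
have [hp pN] := orth_projP h; apply/eqP; rewrite -subr_eq0 -ipBl ipC.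
by apply/eqP/(orth_adherent pN).
Qed.

Lemma norm_orth_proj_le h : `|orth_proj N h| <= `|h|.
Proof.
have [->|p0] := eqVneq (orth_proj N h) 0; first by rewrite normr0.
have pp : 0 < `|orth_proj N h| by rewrite normr_gt0.
rewrite -(ler_pM2r pp) -expr2 normE -ip_orth_proj.
exact: le_trans (ler_norm _) (cauchy_schwarz _ _).
Qed.

(** The quotient norm modulo [N] is the norm of the orthogonal component. For the upper bound,
    subtract from [h] elements of [N] close to [h - orth_proj N h]; for the lower bound, all
    elements of the coset have the same inner product with [orth_proj N h]. *)
Lemma inf_coset h :
  inf [set `|h'| | h' in [set h' | N (h' - h)]] = `|orth_proj N h|.
Proof.
set S := image _ _; have [hp pN] := orth_projP h; have [N0 NP] := Nsub.
have hS : has_inf S.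
  split; first by exists `|h|, h => //=; rewrite subrr.
  by exists 0 => _ [h' _ <-].
apply/eqP; rewrite eq_le; apply/andP; split.
  apply/ler_addgt0Pr => e e0; have [n Nn lt] := hp _ e0.
  apply: (@le_trans _ _ `|h - n|).
    apply: ge_inf; first exact: hS.2.
    exists (h - n) => //=; rewrite addrC addKr -scaleN1r -[_ *: n]addr0.
    exact: NP.
  rewrite -[h - n](subrK (orth_proj N h)) addrC (le_trans (ler_normD _ _))//.
  by rewrite lerD2l addrAC ltW.
apply: lb_le_inf; first exact: hS.1.
move=> _ [h' /= Nh <-].
have [->|p0] := eqVneq (orth_proj N h) 0; first by rewrite normr0.
have pp : 0 < `|orth_proj N h| by rewrite normr_gt0.
rewrite -(ler_pM2r pp) -expr2 normE -ip_orth_proj.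
rewrite (_ : ip h _ = ip h' (orth_proj N h)).
  exact: le_trans (ler_norm _) (cauchy_schwarz _ _).
by apply/esym/eqP; rewrite -subr_eq0 -ipBl ipC pN.
Qed.

End orth_proj_theory.

(** If [phi h0] is nonzero, the component [z] of [h0] orthogonal to the kernel of [phi] satisfies
    [phi z = phi h0], since boundedness makes [phi] vanish on the closure of its kernel. Each [h]
    differs from a multiple of [z] by an element of that kernel. *)
Lemma riesz (phi : E -> R) (C : R) :
  (forall a u v, phi (a *: u + v) = a * phi u + phi v) ->
  (forall u, `|phi u| <= C * `|u|) -> exists u, forall h, ip u h = phi h.
Proof.
move=> phiL phiC.
have phi0 : phi 0 = 0 by have := phiL (-1) 0 0; rewrite scaler0 addr0; lra.
have phiB u v : phi (u - v) = phi u - phi v.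
  by rewrite addrC -scaleN1r phiL mulN1r addrC.
have phiZ a u : phi (a *: u) = a * phi u.
  by rewrite -[a *: u]addr0 phiL phi0 addr0.
pose N := [set h | phi h = 0].
have Nsub : linear_subset N.
  by split => //= a u v; rewrite /N /= phiL => -> ->; rewrite mulr0 addr0.
have Ncl y : adherent N y -> phi y = 0.
  move=> Ny; apply/eqP; rewrite -normr_le0.
  apply/ler_addgt0Pr => e e0; rewrite add0r.
  have C1 : 0 < `|C| + 1 by rewrite ltr_wpDl.
  have [n Nn yn] := Ny _ (divr_gt0 e0 C1).
  rewrite (_ : phi y = phi (y - n)); last by rewrite phiB Nn subr0.
  rewrite (le_trans (phiC _))//.
  apply: (@le_trans _ _ (`|C| * (e / (`|C| + 1)))).
    apply: (le_trans (ler_wpM2r _ (ler_norm _))) => //.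
    by rewrite ler_wpM2l// ltW.
  by rewrite mulrCA ler_piMr ?ltW// ltr_pdivrMr// mul1r ltrDl.
have [phi00|/existsNP[h0 /eqP ph0]] := pselect (forall h, phi h = 0).
  by exists 0 => h; rewrite ip0l phi00.
have [hp pN] := orth_projP Nsub h0; set z := orth_proj N h0 in hp pN.
have phz : phi z = phi h0 by move: (Ncl _ hp); rewrite phiB; lra.
have zz : ip z z != 0.
  apply/eqP => /ip_eq0 z0; move: phz; rewrite z0 phi0 => p0.
  by rewrite -p0 eqxx in ph0.
exists ((phi z / ip z z) *: z) => h.
have /pN : N (h - (phi h / phi z) *: z).
  by rewrite /N /= phiB phiZ divfK ?subrr// phz.
rewrite ipBr ipZr ipZl => /eqP; rewrite subr_eq0 => /eqP ->.
by field; rewrite zz phz ph0.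
Qed.

(** The [z i] may be linearly dependent, so the Gram matrix [G] may be singular. The system is still
    solvable: a vector killed by [G] gives a combination of the [z i] of norm zero, so the
    right-hand side annihilates it too. *)
Lemma normal_equations n (z : 'I_n -> E) x :
  exists c : 'I_n -> R, forall i, ip (x - \sum_j c j *: z j) (z i) = 0.
Proof.
pose G : 'M[R]_n := \matrix_(i, j) ip (z i) (z j).
pose k : 'rV[R]_n := \row_i ip x (z i).
suff /submxP[c kE] : (k <= G)%MS.
  exists (fun j => c 0 j) => i; rewrite ipBl ip_suml.
  have := congr1 (fun M : 'rV[R]_n => M 0 i) kE; rewrite /k !mxE => ->.
  rewrite -sumrB big1// => j _; rewrite ipZl !mxE subrr.
  by [].
rewrite submxE; apply/eqP/matrixP => i j; rewrite ord1 [RHS]mxE.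
pose a l := cokermx G l j.
have a0 l : ip (z l) (\sum_m a m *: z m) = 0.
  have := congr1 (fun M : 'M[R]_n => M l j) (mulmx_coker G).
  rewrite !mxE => <-; rewrite ipC ip_suml; apply: eq_bigr => m _.
  by rewrite ipZl ipC mulrC mxE.
have /ip_eq0 s0 : ip (\sum_m a m *: z m) (\sum_m a m *: z m) = 0.
  by rewrite ip_suml big1// => m _; rewrite ipZl a0 mulr0.
transitivity (ip (\sum_m a m *: z m) x); last by rewrite s0 ip0l.
rewrite ip_suml mxE; apply: eq_bigr => m _.
by rewrite ipZl ipC mulrC [k _ _]mxE.
Qed.

End hilbert.

(** * Derivatives of functions in the RKHS *)

#[local] Arguments pderiv : simpl never.

Section calculus.
Context (R : realType).

(** The mean value theorem for an increment [s] of either sign, as needed for two-sided difference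
    quotients. *)
Lemma mean_value_from0 (phi dphi : R -> R) (s : R) :
  (forall x : R, `|x| <= `|s| -> is_derive x (1 : R) phi (dphi x)) ->
  exists2 c, `|c| <= `|s| & phi s - phi 0 = s * dphi c.
Proof.
move=> dphiP.
have cont (i : interval R) : (forall x, x \in i -> `|x| <= `|s|) ->
    {within [set` i], continuous phi}.
  move=> si; apply: derivable_within_continuous => x /si /dphiP [].
  by [].
have [s0|s0] := leP 0 s.
  have le x : x \in `[0, s] -> `|x| <= `|s|.
    by rewrite in_itv/= => /andP[x0 xs]; rewrite !ger0_norm.
  have [||c cs ->] := @MVT_segment _ phi dphi 0 s s0.
  - by move=> x xs; apply/dphiP/le; exact: subset_itv_oo_cc.
  - exact: cont.
  - by exists c; [exact: le|rewrite subr0 mulrC].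
have le x : x \in `[s, 0] -> `|x| <= `|s|.
  rewrite in_itv/= => /andP[x0 xs].
  by rewrite (ler0_norm xs) (ltr0_norm s0) lerN2.
have [||c cs E] := @MVT_segment _ phi dphi s 0 (ltW s0).
- by move=> x xs; apply/dphiP/le; exact: subset_itv_oo_cc.
- exact: cont.
- by exists c; [exact: le|rewrite -opprB E sub0r mulrN opprK mulrC].
Qed.

Lemma is_derive_line p (U : 'rV[R]_p -> R) (w v : 'rV[R]_p) (s : R) :
  derivable U (w + s *: v) v ->
  is_derive s (1 : R) (fun s => U (w + s *: v)) ('D_v U (w + s *: v)).
Proof.
have E : (fun h : R => h^-1 *:
             (((fun s => U (w + s *: v)) \o shift s) (h *: (1 : R))
             - U (w + s *: v))) =
         (fun h : R => h^-1 *: ((U \o shift (w + s *: v)) (h *: v)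
             - U (w + s *: v))).
  apply/funext => h /=; congr (_ *: (U _ - _)).
  by rewrite [h *: _]mulr1 scalerDl addrCA.
move=> dU; split; rewrite /derivable /derive E //.
Qed.

End calculus.

(** * Balls and coordinate shifts in the product domain *)

Section row_mx_ball.
Context (R : realType) (n : nat).
Implicit Types (x y z w : 'rV[R]_n).

Lemma ball_row_mx y z y' z' (r : R) : ball y r y' -> ball z r z' ->
  ball (row_mx y z) r (row_mx y' z').
Proof.
move=> [r0 yy'] [_ zz']; split => // i j.
by rewrite !mxE; case: splitP => k _.
Qed.

Lemma ball_unit_vec y (r t : R) k :
  `|t| < r -> ball y r (y + t *: unit_vec R k).
Proof.
move=> tr; split=> [|i j]; first exact: le_lt_trans tr.
rewrite !mxE /ball/= opprD addrA subrr sub0r normrN normrM.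
by case: (_ && _); rewrite ?normr1 ?mulr1// normr0 mulr0 (le_lt_trans _ tr).
Qed.

Lemma interior_sqdom (Omega : set 'rV[R]_n) y z :
  Omega° y -> Omega° z -> (sqdom Omega)° (row_mx y z).
Proof.
move=> /nbhs_ballP[r /= r0 yr] /nbhs_ballP[r' /= r'0 zr].
apply/nbhs_ballP; exists (Num.min r r'); first by rewrite /= lt_min r0.
move=> w [_ wyz]; split.
  apply/yr; split=> // i j; have := wyz i (lshift n j).
  by rewrite row_mxEl mxE; apply: le_ball; rewrite ge_min lexx.
apply/zr; split=> // i j; have := wyz i (rshift n j).
by rewrite row_mxEr mxE; apply: le_ball; rewrite ge_min lexx orbT.
Qed.

Lemma row_mx_shiftl y z (t : R) k :
  row_mx (y + t *: unit_vec R k) z = row_mx y z + t *: unit_vec R (lshift n k).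
Proof.
by rewrite /unit_vec delta_mx_lshift scale_row_mx add_row_mx scaler0 addr0.
Qed.

Lemma row_mx_shiftr y z (t : R) k :
  row_mx y (z + t *: unit_vec R k) = row_mx y z + t *: unit_vec R (rshift n k).
Proof.
by rewrite /unit_vec delta_mx_rshift scale_row_mx add_row_mx scaler0 addr0.
Qed.

End row_mx_ball.

(** * Difference quotients of kernel sections *)

Section rkhs_derivative.
Context (R : realType) (n : nat) (Omega : set 'rV[R]_n).
Context (K : 'rV[R]_n -> 'rV[R]_n -> R) (r : nat) (r2 : (2 <= r)%N).
Hypothesis K_Cr : Ck_on r (sqdom Omega) (uncurry_rV K).
Variable k : 'I_n.
Implicit Types x y z : 'rV[R]_n.
Local Notation U := (uncurry_rV K).
Local Notation e := (unit_vec R k).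
Local Notation mixed y z :=
  (pderiv [:: lshift n k; rshift n k] U (row_mx y z)).

(** The mean value theorem is used twice: in the second variable, for the difference of [K] between
    [y + t *: e] and [y], which yields [sigma]; then in the first variable, for the partial
    derivative [G] at height [z + sigma *: e], which yields [tau]. *)
Lemma double_difference y z (d t s : R) :
  ball y d `<=` Omega° -> ball z d `<=` Omega° -> `|t| < d -> `|s| < d ->
  exists tau sigma, [/\ `|tau| <= `|t|, `|sigma| <= `|s| &
    K (y + t *: e) (z + s *: e) - K y (z + s *: e) -
      (K (y + t *: e) z - K y z) =
    t * s * mixed (y + tau *: e) (z + sigma *: e)].
Proof.
move=> yd zd td sd; have [_ dK _] := K_Cr.
have d0 : 0 < d by exact: le_lt_trans td.
have yO t' : `|t'| <= `|t| -> Omega° (y + t' *: e).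
  by move=> t't; apply/yd/ball_unit_vec; exact: le_lt_trans td.
have zO s' : `|s'| <= `|s| -> Omega° (z + s' *: e).
  by move=> s's; apply/zd/ball_unit_vec; exact: le_lt_trans sd.
have yO0 : Omega° y by apply/yd/ballxx.
pose er := unit_vec R (rshift n k); pose el := unit_vec R (lshift n k).
pose G := pderiv [:: rshift n k] U.
have UE a b : U (row_mx a b) = K a b by rewrite /U row_mxKl row_mxKr.
have dr a s' : Omega° a -> `|s'| <= `|s| ->
    is_derive s' (1 : R) (fun s' => U (row_mx a z + s' *: er))
      (G (row_mx a z + s' *: er)).
  move=> aO s's; apply: is_derive_line.
  apply: (dK [::] (rshift n k)); first exact: leq_trans r2.
  by rewrite -row_mx_shiftr; apply: interior_sqdom => //; exact: zO.
have [|sigma ss E1] := @mean_value_from0 R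
  ((fun s' => U (row_mx (y + t *: e) z + s' *: er)) -
   (fun s' => U (row_mx y z + s' *: er)))
  (fun s' => G (row_mx (y + t *: e) z + s' *: er) -
     G (row_mx y z + s' *: er)) s.
  by move=> s' s's; apply: is_deriveB; apply: dr => //; exact: yO.
have [|tau tt E2] := @mean_value_from0 R
  (fun t' => G (row_mx y (z + sigma *: e) + t' *: el))
  (fun t' => 'D_el G (row_mx y (z + sigma *: e) + t' *: el)) t.
  move=> t' t't; apply: is_derive_line.
  apply: (dK [:: rshift n k] (lshift n k)); first exact: r2.
  by rewrite -row_mx_shiftl; apply: interior_sqdom; [exact: yO|exact: zO].
exists tau, sigma; split; [exact: tt|exact: ss|].
move: E1 E2; rewrite !fctE /er /el -!row_mx_shiftr -!row_mx_shiftl.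
rewrite !scale0r !addr0 !UE => -> ->.
by rewrite mulrCA mulrA.
Qed.

(** The number [c] is the value at [(x, x)] of the continuous extension of the mixed derivative, so
    [x] may lie on the boundary. *)
Lemma mixed_near x : Omega x -> exists c : R, forall eps : R, 0 < eps ->
  exists2 d : R, 0 < d & forall y z, Omega° y -> Omega° z ->
    ball x d y -> ball x d z -> `|mixed y z - c| <= eps.
Proof.
move=> Ox; have [_ _ /(_ [:: lshift n k; rshift n k] r2)[F [Fc FE]]] := K_Cr.
exists (F (row_mx x x)) => eps eps0.
have Oxx : sqdom Omega (row_mx x x) by rewrite /sqdom /= row_mxKl row_mxKr.
have /cvgrPdist_le/(_ _ eps0)/nbhs_ballP[d /= d0 dP] :=
  (subspace_continuousP _ _).1 Fc _ Oxx.
exists d => // y z Oy Oz xy xz; have Oyz := interior_sqdom Oy Oz.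
rewrite -(FE _ Oyz) distrC; apply: (dP (row_mx y z)); first exact: ball_row_mx.
exact: interior_subset Oyz.
Qed.

Context (H : rkhs Omega K).
Implicit Type h : H.
Local Notation ker := (rkhs_ker H).
Local Notation ip := (rkhs_ip H).

Lemma ip_ker x y : Omega x -> Omega y -> ip (ker x) (ker y) = K y x.
Proof. by move=> Ox Oy; rewrite rkhs_reproducing// rkhs_kerE. Qed.

(** By the reproducing property, its inner product with [h] is the difference quotient of
    [rkhs_fun h] at [y] along [e]. *)
Definition ker_quot (t : R) y : H := t^-1 *: (ker (y + t *: e) - ker y).

Lemma ip_ker_quot y z (d t s : R) :
  ball y d `<=` Omega° -> ball z d `<=` Omega° ->
  t != 0 -> s != 0 -> `|t| < d -> `|s| < d ->
  exists tau sigma, [/\ `|tau| < d, `|sigma| < d &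
    ip (ker_quot t y) (ker_quot s z) = mixed (z + sigma *: e) (y + tau *: e)].
Proof.
move=> yd zd t0 s0 td sd.
have [sigma [tau [ss tt E]]] := double_difference zd yd sd td.
exists tau, sigma; split; [exact: le_lt_trans td|exact: le_lt_trans sd|].
have d0 : 0 < d by exact: le_lt_trans td.
have O w u : ball w d `<=` Omega° -> `|u| < d -> Omega (w + u *: e).
  by move=> wd ud; apply: interior_subset; apply: wd; exact: ball_unit_vec.
have O0 w : ball w d `<=` Omega° -> Omega w.
  by move=> wd; apply: interior_subset; apply: wd; exact: ballxx.
have Oy := O0 _ yd; have Oz := O0 _ zd.
have Oyt := O _ _ yd td; have Ozs := O _ _ zd sd.
rewrite /ker_quot ipZl ipZr ipBl !ipBr !ip_ker//.
rewrite [X in _ * (_ * X)](_ :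
    _ = s * t * mixed (z + sigma *: e) (y + tau *: e)).
  by field; rewrite t0 s0.
by rewrite -E; ring.
Qed.

(** In the expansion of [|ker_quot t y - ker_quot s z|^2] each of the four inner products is a mixed
    derivative near [(x, x)], hence within [eps^2/4] of the same [c], and the copies of [c] cancel.
    The radius [d] depends on [x] only, while [rho] also depends on how far [y] and [z] are from the
    boundary. *)
Lemma ker_quot_close x (eps : R) : Omega x -> 0 < eps ->
  exists2 d : R, 0 < d & forall y z, Omega° y -> Omega° z ->
    ball x d y -> ball x d z -> exists2 rho : R, 0 < rho &
    forall t s : R, t != 0 -> s != 0 -> `|t| < rho -> `|s| < rho ->
      `|ker_quot t y - ker_quot s z| <= eps.
Proof.
move=> Ox eps0; have [c cP] := mixed_near Ox.
have eps'0 : 0 < eps ^+ 2 / 4 by rewrite divr_gt0// exprn_gt0.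
have [d d0 dP] := cP _ eps'0.
have d20 : 0 < d / 2 by rewrite divr_gt0.
exists (d / 2) => // y z Oy Oz xy xz.
have intO w : Omega° w -> exists2 rw, 0 < rw & ball w rw `<=` Omega°.
  move=> Ow; have /nbhs_ballP[rw /= ? ?] : nbhs w Omega°.
    by apply: open_nbhs_nbhs; split=> //; exact: open_interior.
  by exists rw.
have [ry ry0 yr] := intO _ Oy; have [rz rz0 zr] := intO _ Oz.
(* The bound [d / 2] keeps the shifted points within [d] of [x]; [ry] and [rz] keep them in the
   interior. *)
pose rho := Num.min (d / 2) (Num.min ry rz).
have rho0 : 0 < rho by rewrite !lt_min d20 ry0.
exists rho => // t s t0 s0 tr sr.
have yrho : ball y rho `<=` Omega°.
  by apply: subset_trans yr; apply: le_ball; rewrite !ge_min lexx orbT.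
have zrho : ball z rho `<=` Omega°.
  by apply: subset_trans zr; apply: le_ball; rewrite !ge_min lexx !orbT.
have near w u : ball x (d / 2) w -> `|u| < rho -> ball x d (w + u *: e).
  move=> xw ur; rewrite (splitr d); apply: ball_triangle xw _.
  by apply: ball_unit_vec; rewrite (lt_le_trans ur)// !ge_min lexx.
have ipc w w' t' s' : ball x (d / 2) w -> ball x (d / 2) w' ->
    ball w rho `<=` Omega° -> ball w' rho `<=` Omega° ->
    t' != 0 -> s' != 0 -> `|t'| < rho -> `|s'| < rho ->
    `|ip (ker_quot t' w) (ker_quot s' w') - c| <= eps ^+ 2 / 4.
  move=> xw xw' wO w'O t'0 s'0 t'r s'r.
  have [tau [sigma [tauP sigmaP ->]]] := ip_ker_quot wO w'O t'0 s'0 t'r s'r.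
  apply: dP; [| |exact: near|exact: near].
    by apply/w'O/ball_unit_vec.
  by apply/wO/ball_unit_vec.
rewrite -(@ler_pXn2r _ 2)// ?nnegrE ?(ltW eps0)// rkhs_norm ipBl !ipBr.
rewrite (ipC _ (ker_quot s z) (ker_quot t y)).
have := ipc _ _ _ _ xy xy yrho yrho t0 t0 tr tr.
have := ipc _ _ _ _ xy xz yrho zrho t0 s0 tr sr.
have := ipc _ _ _ _ xz xz zrho zrho s0 s0 sr sr.
rewrite !ler_distl => /andP[? ?] /andP[? ?] /andP[? ?]; lra.
Qed.

Lemma interior_shift y : Omega° y ->
  exists2 d : R, 0 < d & forall t : R, `|t| < d -> Omega (y + t *: e).
Proof.
move=> /nbhs_ballP[d /= d0 yd]; exists d => // t td.
by apply/yd/ball_unit_vec.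
Qed.

Lemma rkhs_quot h y t : Omega y -> Omega (y + t *: e) ->
  t^-1 *: ((rkhs_fun h \o shift y) (t *: e) - rkhs_fun h y) =
  ip h (ker_quot t y).
Proof.
by move=> Oy Oyt; rewrite ipZr ipBr !rkhs_reproducing//= [t *: e + y]addrC.
Qed.

Lemma near_dnbhs0 (d : R) :
  0 < d -> \forall t \near (0 : R)^', t != 0 /\ `|t| < d.
Proof.
move=> d0; near=> t; split; first by near: t; exact: nbhs_dnbhs_neq.
by near: t; apply: dnbhs0_lt.
Unshelve. all: by end_near. Qed.

Lemma rkhs_quot_close h x (eps : R) : Omega x -> 0 < eps ->
  exists2 d : R, 0 < d & forall y z, Omega° y -> Omega° z ->
    ball x d y -> ball x d z -> exists2 rho : R, 0 < rho &
    forall t s : R, t != 0 -> s != 0 -> `|t| < rho -> `|s| < rho ->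
      `|ip h (ker_quot t y) - ip h (ker_quot s z)| < eps.
Proof.
move=> Ox eps0; have h1 : 0 < `|h| + 1 by rewrite ltr_wpDl.
have [d d0 dP] := ker_quot_close Ox (divr_gt0 eps0 h1).
exists d => // y z Oy Oz xy xz; have [rho rho0 rhoP] := dP y z Oy Oz xy xz.
exists rho => // t s t0 s0 tr sr; rewrite -ipBr.
apply: le_lt_trans (cauchy_schwarz (@rkhs_norm _ _ _ _ H) _ _) _.
apply: le_lt_trans (ler_wpM2l _ (rhoP t s t0 s0 tr sr)) _ => //.
by rewrite mulrCA gtr_pMr// ltr_pdivrMr// mul1r ltrDl.
Qed.

(** The case [y = z] of the previous estimate says that the difference quotients at [y] are Cauchy
    as the step tends to 0. *)
Lemma rkhs_quot_cvg h y : Omega° y ->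
  derivable (rkhs_fun h) y e /\
  ip h (ker_quot t y) @[t --> 0^'] --> 'D_e (rkhs_fun h) y.
Proof.
move=> Oy; have Oy' := interior_subset Oy.
have E : {near 0^', (fun t => ip h (ker_quot t y)) =1
    (fun t => t^-1 *: ((rkhs_fun h \o shift y) (t *: e) - rkhs_fun h y))}.
  have [d d0 dP] := interior_shift Oy.
  apply: filterS (near_dnbhs0 d0) => t [_ td].
  by rewrite rkhs_quot//; exact: dP.
have cv : cvg (ip h (ker_quot t y) @[t --> 0^']).
  suff /cauchy_exP/cauchy_cvg :
    cauchy_ex (ip h (ker_quot t y) @[t --> 0^']) by [].
  move=> eps eps0; have [d d0 dP] := rkhs_quot_close h Oy' eps0.
  have [rho rho0 rhoP] := dP y y Oy Oy (ballxx _ d0) (ballxx _ d0).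
  have rho2 : 0 < rho / 2 by rewrite divr_gt0.
  exists (ip h (ker_quot (rho / 2) y)).
  apply: filterS (near_dnbhs0 rho0) => t [t0 tr].
  rewrite -ball_normE /=; apply: rhoP => //; first by rewrite gt_eqF.
  by rewrite gtr0_norm// ltr_pdivrMr// ltr_pMr// ltr1n.
have der : derivable (rkhs_fun h) y e.
  move/cvg_ex: cv => [l cl]; apply/cvg_ex; exists l.
  by apply: cvg_trans cl; apply: near_eq_cvg.
split; first exact: der.
apply: cvg_trans der; apply: near_eq_cvg.
by apply: filterS E => t ->.
Qed.

Lemma rkhs_deriv_close h x (eps : R) : Omega x -> 0 < eps ->
  exists2 d : R, 0 < d & forall y z, Omega° y -> Omega° z ->
    ball x d y -> ball x d z ->
    `|'D_e (rkhs_fun h) y - 'D_e (rkhs_fun h) z| <= eps.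
Proof.
move=> Ox eps0; have [d d0 dP] := rkhs_quot_close h Ox eps0.
exists d => // y z Oy Oz xy xz; have [rho rho0 rhoP] := dP y z Oy Oz xy xz.
have cv : `|ip h (ker_quot t y) - ip h (ker_quot t z)| @[t --> 0^'] -->
    `|'D_e (rkhs_fun h) y - 'D_e (rkhs_fun h) z|.
  by apply: cvg_norm; apply: cvgB; [exact: (rkhs_quot_cvg h Oy).2|
    exact: (rkhs_quot_cvg h Oz).2].
rewrite -(cvg_lim _ cv)//; apply: limr_le.
  by apply/cvg_ex; eexists; exact: cv.
apply: filterS (near_dnbhs0 rho0) => t [t0 tr].
by apply: ltW; exact: rhoP.
Qed.

Hypothesis Omega_closure : Omega = closure Omega°.

Lemma within_interior_proper x : Omega x ->
  ProperFilter (within Omega° (nbhs x)).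
Proof. by move=> Ox; apply: within_nbhs_proper; rewrite -Omega_closure. Qed.

(** The limit defining [bderiv] exists: the derivative has small oscillation on the interior points
    near [x], and such points exist because [Omega] is the closure of its interior. *)
Lemma bderiv_cvg h x : Omega x ->
  'D_e (rkhs_fun h) y @[y --> within Omega° (nbhs x)] -->
  bderiv Omega [:: k] (rkhs_fun h) x.
Proof.
move=> Ox; have PF := within_interior_proper Ox.
suff /cauchy_exP/cauchy_cvg :
  cauchy_ex ('D_e (rkhs_fun h) y @[y --> within Omega° (nbhs x)]) by [].
move=> eps eps0; have e2 : 0 < eps / 2 by rewrite divr_gt0.
have [d d0 dP] := rkhs_deriv_close h Ox e2.
have [z [Oz xz]] : Omega° `&` ball x d !=set0.
  have cx : closure Omega° x by rewrite -Omega_closure.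
  by apply: cx; exact: nbhsx_ballx.
exists ('D_e (rkhs_fun h) z).
have : \forall y \near within Omega° (nbhs x), Omega° y /\ ball x d y.
  apply/nbhs_ballP; exists d => //= y xy Oy; by split.
apply: filterS => y [Oy xy]; rewrite -ball_normE /=.
apply: le_lt_trans (dP z y Oz Oy xz xy) _.
by rewrite ltr_pdivrMr// ltr_pMr// ltr1n.
Qed.

Lemma bderiv_lin a h h' x : Omega x ->
  bderiv Omega [:: k] (rkhs_fun (a *: h + h')) x =
  a * bderiv Omega [:: k] (rkhs_fun h) x + bderiv Omega [:: k] (rkhs_fun h') x.
Proof.
move=> Ox; have PF := within_interior_proper Ox.
have lin : a * 'D_e (rkhs_fun h) y + 'D_e (rkhs_fun h') y
    @[y --> within Omega° (nbhs x)] -->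
  a * bderiv Omega [:: k] (rkhs_fun h) x + bderiv Omega [:: k] (rkhs_fun h') x.
  by apply: cvgD; [apply: cvgMl_tmp|]; exact: bderiv_cvg.
apply: cvg_lim => //; apply: cvg_trans lin; apply: near_eq_cvg.
have OO : within Omega° (nbhs x) Omega° by apply: withinT.
apply: filterS OO => y Oy.
have [cv cv'] := ((rkhs_quot_cvg h Oy).2, (rkhs_quot_cvg h' Oy).2).
have [_ cv2] := rkhs_quot_cvg (a *: h + h') Oy.
have lin2 : ip (a *: h + h') (ker_quot t y) @[t --> 0^'] -->
    a * 'D_e (rkhs_fun h) y + 'D_e (rkhs_fun h') y.
  under eq_fun do rewrite ipDl ipZl.
  by apply: cvgD; [apply: cvgMl_tmp; exact: cv|exact: cv'].
exact: (esym (cvg_unique _ cv2 lin2)).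
Qed.

End rkhs_derivative.

(** * Integrals over Omega *)

Section measurability.
Context (R : realType) (n : nat).
Implicit Types (A Omega : set 'rV[R]_n).

Lemma measurable_forall_coord (B : 'I_n -> set (measurableTypeR R)) :
  (forall i, measurable (B i)) ->
  measurable [set x : 'rV[R]_n | forall i, B i (x 0 i)].
Proof.
move=> mB.
rewrite (_ : mkset _ = \bigcap_i ((@rV_coord R n i) @^-1` B i)).
  apply: fin_bigcap_measurable => // i _; rewrite -[X in measurable X]setTI.
  exact: measurable_rV_coord.
by apply/seteqP; split=> [x Bx i _|x Bx i]; exact: Bx.
Qed.

(** The sigma-algebra is generated by the coordinates, so [A] is written as the countable union of
    the rational boxes that it contains; the other boxes are intersected with an empty set. *)
Lemma open_rV_measurable A : open A -> measurable A.
Proof.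
move=> oA.
pose box (u : 'rV[rat]_n * 'rV[rat]_n) : set 'rV[R]_n :=
  [set x | forall i, `]ratr (u.1 0 i), ratr (u.2 0 i)[%classic (x 0 i)].
have -> : A = \bigcup_u (box u `&` [set _ | box u `<=` A]).
  apply/seteqP; split=> [x Ax|x [u _ [ux]]]; last exact.
  have /nbhs_ballP[r /= r0 xr] : nbhs x A by exact: open_nbhs_nbhs.
  have lo i : exists q : rat, ratr q \in `]x 0 i - r, x 0 i[.
    by apply: rat_in_itvoo; rewrite ltrBlDr ltrDl.
  have hi i : exists q : rat, ratr q \in `]x 0 i, x 0 i + r[.
    by apply: rat_in_itvoo; rewrite ltrDl.
  have [l lP] := choice lo; have [u uP] := choice hi.
  exists (\row_i l i, \row_i u i) => //; split=> [i|y boxy] /=.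
    rewrite !mxE in_itv/=; move: (lP i) (uP i); rewrite !in_itv/=.
    by move=> /andP[_ ->] /andP[->].
  apply: xr; split=> // i j; rewrite ord1; move: (boxy j).
  rewrite /= !mxE in_itv/= /ball/= ltr_distlC => /andP[ly yu].
  move: (lP j) (uP j); rewrite !in_itv/= => /andP[rl _] /andP[_ ur].
  by rewrite (lt_trans rl ly) (lt_trans yu ur).
apply: countable_bigcupT_measurable => // u.
have [uA|uA] := pselect (box u `<=` A).
  rewrite (_ : [set _ | _] = setT) ?setIT; last by apply/seteqP; split.
  apply: (measurable_forall_coord
    (B := fun i => `]ratr (u.1 0 i), ratr (u.2 0 i)[%classic)) => i.
  exact: measurable_itv.
by rewrite (_ : [set _ | _] = set0) ?setI0//; apply/seteqP; split.
Qed.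

Lemma compact_rV_measurable A : compact A -> measurable A.
Proof.
move=> cA; have oA : open (~` A).
  apply: closed_openC; apply: compact_closed cA.
  exact: (@norm_hausdorff R 'rV[R]_n).
by rewrite -[A]setCK; apply: measurableC; exact: open_rV_measurable.
Qed.

Lemma within_continuous_measurable A (h : 'rV[R]_n -> R) :
  measurable A -> {within A, continuous h} ->
  measurable_fun A (h : _ -> measurableTypeR R).
Proof.
move=> mA /continuousP ch.
apply: (measurability _ (RGenOpens.measurableE R)).
move=> _ [_ [a [b ->] <-]].
have oI : open (`]a, b[%classic : set R) by exact: interval_open.
have /open_subspaceP[V oV VE] := ch _ oI.
by rewrite setIC -VE; apply: measurableI => //; exact: open_rV_measurable.
Qed.

Lemma compact_rV_finite A : compact A -> (lebesgue_rV R n A < +oo)%E.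
Proof.
move=> cA; have [M [_ /(_ (M + 1))]] := compact_bounded cA.
rewrite ltrDl ltr01 => /(_ isT) AM.
(* Norms on [A] are at most [M + 1]; the radius [M + 2] makes the inequality strict, as membership
   in an open ball requires. *)
pose I : set (measurableTypeR R) := `[- (M + 2), M + 2]%classic.
pose B : set 'rV[R]_n := [set x | forall i, I (x 0 i)].
have mI : measurable I by exact: measurable_itv.
have sub : A `<=` B.
  move=> x /AM /= xM i.
  have [_ /(_ 0 i)] : ball 0 (M + 2) x.
    rewrite -ball_normE /ball_/= sub0r normrN (le_lt_trans xM)//.
    by rewrite ltrD2l ltr1n.
  by rewrite mxE /ball/= sub0r normrN /I /= in_itv/= -ler_norml => /ltW.
have Bfin : (lebesgue_rV R n B < +oo)%E.
  have -> : lebesgue_rV R n B = (\prod_(i < n) lebesgue_measure I)%E.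
    exact: (@lebesgue_rV_box R n (fun=> I)).
  suff [] : (\prod_(i < n) lebesgue_measure I < +oo)%E /\
    (0 <= \prod_(i < n) lebesgue_measure I)%E by [].
  elim/big_ind: _.
  - by rewrite ltry lee01.
  - move=> x y [xoo x0] [yoo y0]; split; last exact: mule_ge0.
    by rewrite lte_mul_pinfty// ge0_fin_numE.
  - move=> i _; split; last exact: measure_ge0.
    by rewrite lebesgue_measure_itv/=; case: ifP => //; rewrite -EFinB ltry.
apply: le_lt_trans Bfin; apply: le_measure => //; rewrite ?inE.
  exact: compact_rV_measurable.
exact: (measurable_forall_coord (B := fun=> I)).
Qed.

End measurability.

(** * Pairing a square-integrable function with a bounded continuous one *)

Section pairing.
Context (R : realType) (n : nat) (Omega : set 'rV[R]_n).
Hypothesis Omega_compact : compact Omega.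
Local Notation leb := (lebesgue_rV R n).
Let mO : measurable Omega := compact_rV_measurable Omega_compact.

(** The square root of the Lebesgue measure of [Omega]. *)
Let c : R := fine ('N[leb]_2%:E[EFin \o \1_Omega])%E.

Lemma L2_abs_integral (p : 'rV[R]_n -> R) : in_L2 Omega p ->
  (\int[leb]_(x in Omega) `|p x|%:E <= (normL2 Omega p * c)%:E)%E.
Proof.
rewrite /in_L2 inE => /andP[/[!inE]/= mp pfin].
have m1 : measurable_fun setT (\1_Omega : 'rV[R]_n -> R).
  exact: measurable_indic.
have [p2 c2] : ('N[leb]_2%:E[EFin \o p \_ Omega])%E \is a fin_num /\
    ('N[leb]_2%:E[EFin \o \1_Omega])%E \is a fin_num.
  split; rewrite ge0_fin_numE ?Lnorm_ge0//.
  rewrite unlock poweR_lty//.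
  rewrite (_ : (fun x => _) = (fun x => (\1_Omega x)%:E)).
    by rewrite integral_indic// setIT; exact: compact_rV_finite.
  apply/funext => x /=; rewrite indicE; case: (_ \in _).
    by rewrite normr1 powR1.
  by rewrite normr0 powR0.
rewrite EFinM /normL2 /c !fineK//.
(* Cauchy-Schwarz for [p] against the indicator of [Omega] bounds the integral of [|p|]. *)
have := @hoelder _ _ _ leb (p \_ Omega) \1_Omega 2 2 mp m1.
rewrite ltr0n => /(_ isT isT); rewrite Lnorm1 => H.
apply: le_trans (H _); last by lra.
rewrite [leLHS]integral_mkcond le_eqVlt; apply/orP; left; apply/eqP.
apply: eq_integral => x _; rewrite /= !patchE indicE; case: ifP => _.
  by rewrite mulr1.
by rewrite mulr0 normr0.
Qed.

Lemma L2_pairing (p h : 'rV[R]_n -> R) (B : R) : in_L2 Omega p -> 0 <= B ->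
  {within Omega, continuous h} -> (forall x, Omega x -> `|h x| <= B) ->
  leb.-integrable Omega (EFin \o (fun x => h x * p x)) /\
  `|\int[leb]_(x in Omega) (h x * p x)| <= B * (normL2 Omega p * c).
Proof.
move=> pL2 B0 ch hB.
have mh := within_continuous_measurable mO ch.
have mp : measurable_fun Omega p.
  move: pL2; rewrite /in_L2 inE => /andP[/[!inE]/= + _].
  exact: (measurable_restrictT _ mO).2.
have ip : leb.-integrable Omega (EFin \o p).
  apply/integrableP; split; first exact/measurable_EFinP.
  apply: le_lt_trans (L2_abs_integral pL2) _; exact: ltry.
have ihp : leb.-integrable Omega (EFin \o (fun x => h x * p x)).
  apply: (@le_integrable _ _ _ _ _ mO _ (fun x => B%:E * (EFin \o p) x)%E).
  - by apply/measurable_EFinP; exact: measurable_funM.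
  - move=> x Ox; rewrite -EFinM /= lee_fin !normrM ler_wpM2r//.
    exact: le_trans (hB _ Ox) (ler_norm _).
  - exact: integrableZl.
split=> //; rewrite -lee_fin EFin_normr_Rintegral//.
have mhp : measurable_fun Omega (EFin \o (fun x => h x * p x)).
  by case/integrableP: ihp.
have mabs : measurable_fun Omega (fun x => `|p x|%:E).
  by apply/measurable_EFinP; exact: measurableT_comp.
apply: le_trans (le_abse_integral _ mO mhp) _.
apply: (@le_trans _ _ (\int[leb]_(x in Omega) (B%:E * `|p x|%:E))%E).
  apply: ge0_le_integral => //.
  - exact: measurableT_comp.
  - exact: measurable_funeM.
  - by move=> x Ox; rewrite -EFinM lee_fin normrM ler_wpM2r//; exact: hB.
rewrite ge0_integralZl//.
by rewrite EFinM lee_wpmul2l// ?lee_fin// L2_abs_integral.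
Qed.

End pairing.

(** * The power function *)

Section rkhs_facts.
Context (R : realType) (n : nat) (Omega : set 'rV[R]_n).
Context (K : 'rV[R]_n -> 'rV[R]_n -> R) (H : rkhs Omega K).
Implicit Types (h : H) (x y : 'rV[R]_n).
Local Notation ker := (rkhs_ker H).
Local Notation ip := (rkhs_ip H).
Let normE := @rkhs_norm _ _ _ _ H.

Lemma norm_ker x : Omega x -> `|ker x| = Num.sqrt (K x x).
Proof. by move=> Ox; rewrite -(ip_ker H Ox Ox) -normE sqrtr_sqr normr_id. Qed.

Lemma rkhs_fun_le h x : Omega x -> `|rkhs_fun h x| <= `|h| * Num.sqrt (K x x).
Proof.
move=> Ox; rewrite -norm_ker// -rkhs_reproducing//.
exact: cauchy_schwarz.
Qed.

Hypothesis K_bounded : diag_bounded_on Omega K.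

Lemma has_ubound_sqrt_diag : has_ubound [set Num.sqrt (K x x) | x in Omega].
Proof.
have [M KM] := K_bounded; exists (Num.sqrt M) => _ [x Ox <-].
exact/ler_wsqrtr/KM.
Qed.

Lemma rkhs_fun_le_sup h x : Omega x ->
  `|rkhs_fun h x| <= `|h| * sup [set Num.sqrt (K x x) | x in Omega].
Proof.
move=> Ox; apply: le_trans (rkhs_fun_le h Ox) _; rewrite ler_wpM2l//.
by apply: ub_le_sup; [exact: has_ubound_sqrt_diag|exists x].
Qed.

Lemma sup_image_ge0 (F : 'rV[R]_n -> R) :
  has_ubound [set F x | x in Omega] -> (forall x, Omega x -> 0 <= F x) ->
  0 <= sup [set F x | x in Omega].
Proof.
move=> uF F0; have [[x Ox]|/set0P/negP/negPn/eqP ->] := pselect (Omega !=set0).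
  by apply: le_trans (F0 x Ox) _; apply: ub_le_sup => //; exists x.
by rewrite image_set0 sup0.
Qed.

(** The square of [|ker x - ker y|] is a signed sum of four values of [K] that all tend to [K x x]
    and cancel as [y] tends to [x]; Cauchy-Schwarz carries this over to [h]. *)
Lemma rkhs_fun_continuous h :
  {within sqdom Omega, continuous (uncurry_rV K)} ->
  {within Omega, continuous (rkhs_fun h)}.
Proof.
move=> Kc; apply/subspace_continuousP => x Ox; apply/cvgrPdist_lt => eps eps0.
have h1 : 0 < `|h| + 1 by rewrite ltr_wpDl.
have eps'0 : 0 < (eps / (`|h| + 1)) ^+ 2 / 4.
  by rewrite divr_gt0// exprn_gt0// divr_gt0.
have sq y z : Omega y -> Omega z -> sqdom Omega (row_mx y z).
  by move=> Oy Oz; rewrite /sqdom /= row_mxKl row_mxKr.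
have UE y z : uncurry_rV K (row_mx y z) = K y z.
  by rewrite /uncurry_rV row_mxKl row_mxKr.
have /cvgrPdist_lt/(_ _ eps'0)/nbhs_ballP[d /= d0 dP] :=
  (subspace_continuousP _ _).1 Kc _ (sq _ _ Ox Ox).
have Kd y z : Omega y -> Omega z -> ball x d y -> ball x d z ->
    `|K x x - K y z| < (eps / (`|h| + 1)) ^+ 2 / 4.
  move=> Oy Oz xy xz; rewrite -!UE.
  by apply: (dP (row_mx y z)); [exact: ball_row_mx|exact: sq].
apply/nbhs_ballP; exists d => // y xy Oy /=.
change (`|rkhs_fun h x - rkhs_fun h y| < eps).
rewrite -!(rkhs_reproducing h)// -ipBr.
apply: le_lt_trans (cauchy_schwarz normE _ _) _.
suff k : `|ker x - ker y| <= eps / (`|h| + 1).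
  apply: le_lt_trans (ler_wpM2l _ k) _ => //.
  by rewrite mulrCA gtr_pMr// ltr_pdivrMr// mul1r ltrDl.
have e0 : 0 <= eps / (`|h| + 1) by rewrite ltW// divr_gt0.
rewrite -(@ler_pXn2r _ 2)// ?nnegrE// normE ipBl !ipBr !ip_ker//.
have := Kd _ _ Oy Ox xy (ballxx _ d0); have := Kd _ _ Ox Oy (ballxx _ d0) xy.
have := Kd _ _ Oy Oy xy xy; rewrite !ltr_distl.
move: (_ ^+ 2) (K _ _) (K _ _) (K _ _) (K _ _) => q a b c d'.
by move=> /andP[? ?] /andP[? ?] /andP[? ?]; lra.
Qed.

Lemma normLoo_le h (B : R) : 0 <= B ->
  (forall x, Omega x -> `|rkhs_fun h x| <= B) ->
  (normLoo Omega (rkhs_fun h) <= B%:E)%E.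
Proof.
move=> B0 hB; rewrite /normLoo unlock; case: ifPn => _; last by rewrite lee_fin.
apply/ess_supP/nearW => x /=; rewrite lee_fin patchE.
by case: ifPn => [/set_mem/hB//|_]; rewrite normr0.
Qed.

Hypothesis Omega_compact : compact Omega.
Hypothesis K_sym : symmetric_on Omega K.
Hypothesis K_cont : {within sqdom Omega, continuous (uncurry_rV K)}.

(** The point is that [ip v h] equals the integral of [h * p]. That integral is a bounded functional
    of [h], so some [u] represents it; testing on kernel sections and using the symmetry of [K]
    gives [u] the values of [LK Omega K p], whence [u = v]. *)
Lemma ip_LK : exists2 c : R, 0 <= c & forall (p : 'rV[R]_n -> R) (v : H),
  in_L2 Omega p -> (forall x, Omega x -> rkhs_fun v x = LK Omega K p x) ->
  forall h (B : R), 0 <= B -> (forall x, Omega x -> `|rkhs_fun h x| <= B) ->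
  `|ip v h| <= B * (normL2 Omega p * c).
Proof.
exists (fine ('N[lebesgue_rV R n]_2%:E[EFin \o \1_Omega])%E).
  by rewrite fine_ge0// Lnorm_ge0.
move=> p v pL2 vE.
have pair h (B : R) (B0 : 0 <= B) :=
  L2_pairing Omega_compact pL2 B0 (rkhs_fun_continuous (h := h) K_cont).
set c := fine _ in pair *.
pose kappa := sup [set Num.sqrt (K x x) | x in Omega].
pose phi h := \int[lebesgue_rV R n]_(x in Omega) (rkhs_fun h x * p x).
have kappa0 : 0 <= kappa.
  apply: sup_image_ge0; first exact: has_ubound_sqrt_diag.
  by move=> x _; exact: sqrtr_ge0.
(* This cruder bound, proportional to [|h|], gives integrability and the boundedness that [riesz]
   requires; the finer [B] enters only in the conclusion. *)
have pairk h := pair h (`|h| * kappa) (mulr_ge0 (normr_ge0 h) kappa0)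
  (@rkhs_fun_le_sup h).
have phiL a h h' : phi (a *: h + h') = a * phi h + phi h'.
  rewrite /phi -RintegralZl//;
    [|exact: compact_rV_measurable|exact: (pairk h).1].
  rewrite -RintegralD//; [|exact: compact_rV_measurable| |exact: (pairk h').1].
    apply: eq_Rintegral => x /set_mem Ox; rewrite rkhs_fun_linear//.
    by rewrite mulrDl mulrA.
  have := integrableZl (compact_rV_measurable Omega_compact) a (pairk h).1.
  by [].
have [u uE] : exists u, forall h, ip u h = phi h.
  apply: (riesz normE (C := kappa * (normL2 Omega p * c))) => // h.
  by rewrite mulrC mulrA; exact: (pairk h).2.
suff -> : v = u by move=> h B B0 hB; rewrite uE; exact: (pair h B B0 hB).2.
apply: (rkhs_fun_inj (r := H)) => x Ox; rewrite vE// -(rkhs_reproducing u)// uE.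
apply: eq_Rintegral => y /set_mem Oy.
by rewrite rkhs_kerE// K_sym.
Qed.

Hypothesis K_pos : strictly_positive_on Omega K.

Section power.
Variables (N : nat) (xi : 'I_N -> 'rV[R]_n).
Hypotheses (xiO : forall i, Omega (xi i)) (xi_inj : injective xi).

Lemma gram_unitmx : gram K xi \in unitmx.
Proof.
rewrite unitmxE unitfE; apply/negP => /det0P[w w0 wG].
have : w^T != 0 by apply: contra_neq w0 => w0; rewrite -[w]trmxK w0 trmx0.
by move/(K_pos xiO xi_inj); rewrite trmxK wG mul0mx mxE ltxx.
Qed.

(** The coefficients [d] solve the Gram system, so [ker x - w] is orthogonal to the span of the
    [ker (xi i)]. Its squared norm is then [ip (ker x) (ker x - w)], the expression under the root,
    and the power function is the distance from [ker x] to that span. *)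
Lemma power_funE x : Omega x -> exists d : 'I_N -> R,
  power_fun K xi x = `|ker x - \sum_i d i *: ker (xi i)| /\
  power_fun K xi x <= Num.sqrt (K x x).
Proof.
move=> Ox; pose k := kvec K xi x; pose d := invmx (gram K xi) *m k.
exists (fun i => d i 0); set w := \sum_i _.
have Gd : gram K xi *m d = k by rewrite mulKVmx// gram_unitmx.
have wort i : ip (ker x - w) (ker (xi i)) = 0.
  rewrite ipBl ip_ker// ip_suml.
  have := congr1 (fun M : 'cV[R]_N => M i 0) Gd; rewrite [RHS]mxE K_sym// => <-.
  rewrite mxE -sumrB big1// => j _; rewrite ipZl ip_ker// mxE mulrC subrr.
  by [].
have ww : ip (ker x - w) w = 0.
  rewrite ipC ip_suml big1// => i _.
  by rewrite ipZl ipC wort mulr0.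
have E : ip (ker x) (ker x - w) =
    K x x - (k^T *m invmx (gram K xi) *m k) 0 0.
  rewrite ipBr ip_ker// -mulmxA; congr (_ - _).
  rewrite ipC ip_suml mxE; apply: eq_bigr => i _.
  by rewrite ipZl ipC ip_ker// !mxE mulrC K_sym.
have sq : `|ker x - w| ^+ 2 = ip (ker x) (ker x - w).
  by rewrite normE {1}ipBl (ipC _ w) ww subr0.
have pE : power_fun K xi x = `|ker x - w|.
  by rewrite /power_fun -/k -E -sq sqrtr_sqr normr_id.
split=> //; rewrite pE.
have [->|w0] := eqVneq (ker x - w) 0; first by rewrite normr0 sqrtr_ge0.
have n0 : 0 < `|ker x - w| by rewrite normr_gt0.
rewrite -norm_ker// -(ler_pM2r n0) -expr2 sq.
exact: le_trans (ler_norm _) (cauchy_schwarz normE _ _).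
Qed.

Lemma has_ubound_power_fun : has_ubound [set power_fun K xi x | x in Omega].
Proof.
have [M KM] := K_bounded; exists (Num.sqrt M) => _ [x Ox <-].
have [d [_ le]] := power_funE Ox; apply: le_trans le _.
exact/ler_wsqrtr/KM.
Qed.

End power.

Lemma HN_approx : exists2 c : R, 0 <= c & forall (p : 'rV[R]_n -> R) (v : H),
  in_L2 Omega p -> (forall x, Omega x -> rkhs_fun v x = LK Omega K p x) ->
  forall N (xi : 'I_N -> 'rV[R]_n), (forall i, Omega (xi i)) -> injective xi ->
  exists2 u, HN H xi u & `|v - u| <=
    sup [set power_fun K xi x | x in Omega] * (normL2 Omega p * c).
Proof.
have [c c0 cP] := ip_LK; exists c => // p v pL2 vE N xi xiO xi_inj.
have [a aP] := normal_equations normE (fun i => ker (xi i)) v.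
exists (\sum_j a j *: ker (xi j)); first by exists a.
set e := v - _; set S := sup _.
have eHN d : ip e (\sum_i d i *: ker (xi i)) = 0.
  by rewrite ipC ip_suml big1// => i _; rewrite ipZl ipC aP mulr0.
have S0 : 0 <= S.
  apply: sup_image_ge0; first exact: has_ubound_power_fun.
  by move=> x _; exact: sqrtr_ge0.
have eB x : Omega x -> `|rkhs_fun e x| <= `|e| * S.
  move=> Ox; have [d [pE _]] := power_funE xiO xi_inj Ox.
  rewrite -rkhs_reproducing//.
  (* Since [e] is orthogonal to the span, [ker x] may be replaced by its residual, whose norm is the
     power function at [x]. *)
  rewrite (_ : ip e _ = ip e (ker x - \sum_i d i *: ker (xi i))); last first.
    by rewrite ipBr eHN subr0.
  apply: le_trans (cauchy_schwarz normE _ _) _; rewrite -pE ler_wpM2l//.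
  by apply: ub_le_sup; [exact: has_ubound_power_fun|exists x].
have [->|e0] := eqVneq e 0.
  rewrite normr0 mulr_ge0// mulr_ge0// /normL2.
  by rewrite fine_ge0// Lnorm_ge0.
have n0 : 0 < `|e| by rewrite normr_gt0.
(* The sup bound on [e] already contains a factor [|e|], so [|e|^2 = ip v e] can be divided by
   [|e|]. *)
rewrite -(ler_pM2l n0) mulrA -expr2 normE.
apply: le_trans (cP p v pL2 vE e _ (mulr_ge0 (normr_ge0 _) S0) eB).
by rewrite {1}/e ipBl (ipC _ (\sum_j _)) eHN subr0 ler_norm.
Qed.

End rkhs_facts.

(** * The Galerkin scheme *)

Lemma lspan_lin (R : realType) (E : lmodType R) N (e : 'I_N -> E) a x y :
  lspan e x -> lspan e y -> lspan e (a *: x + y).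
Proof.
move=> [c _ <-] [d _ <-]; exists (fun i => a * c i + d i); first by [].
rewrite scaler_sumr -big_split; apply: eq_bigr => i _ /=.
by rewrite scalerDl scalerA.
Qed.

Section galerkin_theory.
Context (R : realType) (n m : nat) (Omega : set 'rV[R]_n).
Context (K : 'rV[R]_n -> 'rV[R]_n -> R) (H : rkhs Omega K).
Context (f : 'rV[R]_n -> 'rV[R]_n) (g : 'rV[R]_n -> 'M[R]_(n, m)).
Context (mu : 'rV[R]_n -> 'rV[R]_m).
Implicit Types (h u : H).
Local Notation A := (@opA R n m Omega K H f g mu).
Local Notation ker := (rkhs_ker H).
Local Notation ip := (rkhs_ip H).
Let normE := @rkhs_norm _ _ _ _ H.

Hypothesis A_lin : forall a h h', A (a *: h + h') = a *: A h + A h'.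

Let A0 : A 0 = 0.
Proof.
have := A_lin (-1) 0 0; rewrite scaler0 addr0 scaleN1r addNr => ->.
by [].
Qed.

Let AZ a h : A (a *: h) = a *: A h.
Proof. by rewrite -[a *: h]addr0 A_lin A0 addr0. Qed.

Let AD h h' : A (h + h') = A h + A h'.
Proof. by rewrite -[h]scale1r A_lin !scale1r. Qed.

Let AB h h' : A (h - h') = A h - A h'.
Proof. by rewrite addrC -scaleN1r A_lin scaleN1r [RHS]addrC. Qed.

Let A_sum N (c : 'I_N -> R) (z : 'I_N -> H) :
  A (\sum_i c i *: z i) = \sum_i c i *: A (z i).
Proof. by rewrite (big_morph _ AD A0); apply: eq_bigr => i _; rewrite AZ. Qed.

Definition kerA : set H := [set h | A h = 0].

Let kerA_sub : linear_subset kerA.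
Proof.
split; [exact: A0|move=> a u v Au Av].
have Auv : A (a *: u + v) = 0.
  by rewrite A_lin (Au : A u = 0) (Av : A v = 0) scaler0 addr0.
exact: Auv.
Qed.

(** The projection onto the orthogonal complement of the kernel of [A]. *)
Local Notation P := (orth_proj ip kerA).

Let P_lin a h h' : P (a *: h + h') = a *: P h + P h'.
Proof. exact: (orth_proj_lin normE kerA_sub). Qed.

Let P0 : P 0 = 0.
Proof.
have := P_lin (-1) 0 0; rewrite scaler0 addr0 scaleN1r addNr => ->.
by [].
Qed.

Let PZ a h : P (a *: h) = a *: P h.
Proof. by rewrite -[a *: h]addr0 P_lin P0 addr0. Qed.

Let PD h h' : P (h + h') = P h + P h'.
Proof. by rewrite -[h]scale1r P_lin !scale1r. Qed.

Let PB h h' : P (h - h') = P h - P h'.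
Proof. by rewrite addrC -scaleN1r P_lin scaleN1r [RHS]addrC. Qed.

(** The fibre of [A] over [A h] is the coset of [h] modulo the kernel, so [normW] is a quotient
    norm. *)
Lemma normWE h : normW H f g mu (A h) = `|P h|.
Proof.
rewrite /normW -(inf_coset normE kerA_sub); congr inf; congr image.
apply/seteqP; split=> h'; rewrite /kerA /= AB.
  by move=> ->; rewrite subrr.
by move/eqP; rewrite subr_eq0 => /eqP.
Qed.

Lemma ipWE h h' : ipW H f g mu (A h) (A h') = ip (P h) (P h').
Proof.
have ED : normW H f g mu (A h + A h') = `|P h + P h'|.
  by rewrite -PD -normWE AD.
have EB : normW H f g mu (A h - A h') = `|P h - P h'|.
  by rewrite -PB -normWE AB.
by rewrite /ipW ED EB (polarization normE).
Qed.

Section scheme.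
Variables (N : nat) (xi : 'I_N -> 'rV[R]_n).
Hypothesis WN_sub : WN Omega K f g mu xi `<=` rangeA H f g mu.
Hypothesis wd : galerkin_well_defined H f g mu xi.
Local Notation T h := (galerkin H f g mu xi (A h)).

(** Preimages under [A] of the generators of [W_N] transfer all computations in [W] to the Hilbert
    space [H]. *)
Let z_sig : {z : 'I_N -> H & forall i, A (z i) = wsec Omega K f g mu (xi i)}.
Proof.
apply: (@choice _ _ (fun i z => A z = wsec Omega K f g mu (xi i))) => i.
have /WN_sub[z _ zE] : WN Omega K f g mu xi (wsec Omega K f g mu (xi i)).
  exists (fun j => (i == j)%:R) => //.
  rewrite (bigD1 i)//= eqxx scale1r big1 ?addr0// => j.
  by rewrite eq_sym => /negPf ->; rewrite scale0r.
by exists z.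
Qed.

Let z := projT1 z_sig.
Let zE : forall i, A (z i) = wsec Omega K f g mu (xi i) := projT2 z_sig.

Let WNE w : WN Omega K f g mu xi w <->
  exists c : 'I_N -> R, w = A (\sum_i c i *: z i).
Proof.
split=> [[c _ <-]|[c ->]]; exists c => //; rewrite A_sum.
  by apply: eq_bigr => i _; rewrite zE.
by apply: eq_bigr => i _; rewrite zE.
Qed.

(* A h and A h' have the same W-inner products with WN. *)
Let equiv h h' := forall i, ip (P (h - h')) (P (z i)) = 0.

Let equivN h h' : equiv h h' -> equiv h' h.
Proof.
by move=> e i; rewrite -opprB -scaleN1r PZ ipZl e mulr0.
Qed.

Let equivT h1 h2 h3 : equiv h1 h2 -> equiv h2 h3 -> equiv h1 h3.
Proof.
move=> e12 e23 i; rewrite (_ : h1 - h3 = (h1 - h2) + (h2 - h3)).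
  by rewrite PD ipDl e12 e23 addr0.
by rewrite addrA subrK.
Qed.

Let orthW h h' : (forall w, WN Omega K f g mu xi w ->
    ipW H f g mu (A h - A h') w = 0) <-> equiv h h'.
Proof.
split=> [e i|e w /WNE[c ->]].
  rewrite -ipWE AB; apply: e; apply/WNE; exists (fun j => (i == j)%:R).
  congr A; rewrite (bigD1 i)//= eqxx scale1r big1 ?addr0// => j.
  by rewrite eq_sym => /negPf ->; rewrite scale0r.
rewrite -AB ipWE (big_morph _ PD P0) ipC ip_suml big1// => i _.
by rewrite PZ ipZl ipC e mulr0.
Qed.

Let projWP h : exists y, [/\ projW H f g mu (WN Omega K f g mu xi) (A h) = A y,
  WN Omega K f g mu xi (A y) & equiv h y].
Proof.
set S := [set u | WN Omega K f g mu xi u /\ forall w,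
  WN Omega K f g mu xi w -> ipW H f g mu (A h - u) w = 0].
have [Sw we] : S (projW H f g mu (WN Omega K f g mu xi) (A h)).
  (* A solution of the normal equations for the vectors [P (z i)] shows that the set is nonempty, so
     [get] returns a genuine projection. *)
  apply: getPex; have [c cP] := normal_equations normE (fun i => P (z i)) (P h).
  exists (A (\sum_i c i *: z i)); split; first by apply/WNE; exists c.
  apply/orthW => i; rewrite PB (big_morph _ PD P0).
  under eq_bigr do rewrite PZ.
  exact: cP.
have [c wE] := (WNE _).1 Sw; exists (\sum_i c i *: z i).
split; [exact: wE|by rewrite -wE|].
by apply/orthW => w Ww; rewrite -wE; exact: we.
Qed.

Let projW_equiv h h' : equiv h h' ->
  projW H f g mu (WN Omega K f g mu xi) (A h) =
  projW H f g mu (WN Omega K f g mu xi) (A h').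
Proof.
move=> hh'.
pose S h := [set u | WN Omega K f g mu xi u /\ forall w,
  WN Omega K f g mu xi w -> ipW H f g mu (A h - u) w = 0].
suff SS : S h = S h' by exact: (congr1 (fun S => get S) SS).
apply/seteqP; split=> u [Wu ue]; (split; first exact: Wu);
  have [c uE] := (WNE _).1 Wu; move: ue; rewrite uE => /orthW ue; apply/orthW.
- exact: equivT (equivN hh') ue.
- exact: equivT hh' ue.
Qed.

(* [get] in [projW] returns the same function for equal sets, so surjectivity of
   [galerkin_op] onto WN rules out any ambiguity in the W-projection: it is not
   necessary to know that [normW] is definite on WN. *)
Let galerkin_op_galerkin h : HN H xi (T h) /\
  galerkin_op f g mu xi (T h) = projW H f g mu (WN Omega K f g mu xi) (A h).
Proof.
have [_ _ surj] := wd; have [y [pE Wy _]] := projWP h.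
have Wp : WN Omega K f g mu xi (projW H f g mu (WN Omega K f g mu xi) (A h)).
  by rewrite pE.
split; last by apply: pinvK; apply: mem_set; exact: surj.
by apply: (surjpinv_image_sub (dflt := fun=> 0) surj); eexists; first exact: Wp.
Qed.

(** Galerkin orthogonality: [A (T h)] and [A h] have the same projection on [W_N], and each is
    equivalent to a preimage of that projection. *)
Let galerkin_equiv h : equiv (T h) h.
Proof.
have [_ TE] := galerkin_op_galerkin h; have [y [pE _ hy]] := projWP h.
have [y' [pE' _ Ty']] := projWP (T h).
have yy' : A y' = A y := etrans (esym pE') (etrans TE pE).
move/orthW: Ty'; rewrite yy' => /orthW Ty.
exact: equivT Ty (equivN hy).
Qed.

(** Equivalent elements have equal projections and [galerkin_op] is injective on [H_N]; so Galerkin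
    orthogonality characterizes [T h], from which linearity and the identity on [H_N] follow. *)
Let galerkin_unique u h : HN H xi u -> equiv u h -> u = T h.
Proof.
have [_ inj _] := wd => Hu uh; have [HT _] := galerkin_op_galerkin h.
apply: inj; [exact: mem_set|exact: mem_set|].
exact/projW_equiv/(equivT uh)/equivN/galerkin_equiv.
Qed.

Lemma galerkin_in_HN h : HN H xi (T h).
Proof. exact: (galerkin_op_galerkin h).1. Qed.

Lemma galerkin_lin a h h' : T (a *: h + h') = a *: T h + T h'.
Proof.
apply/esym/galerkin_unique.
  exact: lspan_lin (galerkin_in_HN h) (galerkin_in_HN h').
move=> i; rewrite opprD addrACA -scalerBr P_lin ipDl ipZl.
by rewrite (galerkin_equiv h) (galerkin_equiv h') mulr0 addr0.
Qed.

Lemma galerkin_id u : HN H xi u -> T u = u.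
Proof.
by move=> Hu; apply/esym/galerkin_unique => // i; rewrite subrr P0 ip0l.
Qed.

(** [T h] depends on [h] only through the finite vector [l h] of inner products, each bounded by a
    multiple of [|h|]. The constant may depend on [N]. *)
Lemma galerkin_bounded : exists C : R, forall h, `|T h| <= C * `|h|.
Proof.
pose M : 'M[R]_N := \matrix_(j, i) ip (P (ker (xi j))) (P (z i)).
pose l h : 'rV[R]_N := \row_i ip (P h) (P (z i)).
have lE (c : 'rV[R]_N) : l (\sum_j c 0 j *: ker (xi j)) = c *m M.
  apply/rowP => i; rewrite !mxE (big_morph _ PD P0) ip_suml.
  by apply: eq_bigr => j _; rewrite PZ ipZl mxE.
have equivl h h' : equiv h h' <-> l h = l h'.
  split=> [e|/rowP e i]; last first.
    by have := e i; rewrite !mxE PB ipBl => ->; rewrite subrr.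
  by apply/rowP => i; rewrite !mxE; apply/eqP; rewrite -subr_eq0 -ipBl -PB e.
(* The coefficients must solve [c *m M = l h]. The system is consistent because the coefficients of
   [T h] itself solve it, so [pinvmx] gives a solution that is linear in [l h]. *)
have TE h : T h = \sum_j (l h *m pinvmx M) 0 j *: ker (xi j).
  apply/esym/galerkin_unique; first by exists (fun j => (l h *m pinvmx M) 0 j).
  apply/equivl; rewrite lE mulmxKpV//.
  have [c _ cE] := galerkin_in_HN h.
  have <- : l (T h) = l h by apply/equivl; exact: galerkin_equiv.
  rewrite -cE (_ : l _ = (\row_j c j) *m M) ?submxMl// -lE.
  by congr l; apply: eq_bigr => j _; rewrite mxE.
exists (\sum_j (\sum_i `|P (z i)| * `|pinvmx M i j|) * `|ker (xi j)|) => h.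
rewrite TE mulr_suml; apply: le_trans (ler_norm_sum _ _ _) _.
apply: ler_sum => j _; rewrite normrZ [leRHS]mulrAC ler_wpM2r//.
rewrite mxE mulr_suml; apply: le_trans (ler_norm_sum _ _ _) _.
apply: ler_sum => i _; rewrite normrM [leRHS]mulrAC ler_wpM2r// mxE.
apply: le_trans (cauchy_schwarz normE _ _) _; rewrite mulrC ler_wpM2l//.
exact: (norm_orth_proj_le normE kerA_sub).
Qed.

End scheme.
End galerkin_theory.

(** * Uniform boundedness of the Galerkin operators *)

Section uniform_bound.
Context (R : realType) (n m : nat) (Omega : set 'rV[R]_n).
Context (K : 'rV[R]_n -> 'rV[R]_n -> R) (H : rkhs Omega K).
Context (f : 'rV[R]_n -> 'rV[R]_n) (g : 'rV[R]_n -> 'M[R]_(n, m)).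
Context (mu : 'rV[R]_n -> 'rV[R]_m).
Local Notation A := (@opA R n m Omega K H f g mu).

Lemma opA_lin (r : nat) : (2 <= r)%N ->
  Ck_on r (sqdom Omega) (uncurry_rV K) -> Omega = closure Omega° ->
  forall a h h', A (a *: h + h') = a *: A h + A h'.
Proof.
move=> r2 K_Cr Ocl a h h'; apply/funext => x.
have AE u : A u x = if x \in Omega then
  \sum_(k < n) coef f g mu k x * bderiv Omega [:: k] (rkhs_fun u) x else 0 :=
  erefl.
apply: etrans (AE _) _.
apply: etrans (esym (congr2 (fun s t => a * s + t) (AE h) (AE h'))).
case: (boolP (x \in Omega)) => [/set_mem Ox|_]; last by rewrite mulr0 addr0.
rewrite mulr_sumr -big_split; apply: eq_bigr => k _.
by rewrite (bderiv_lin r2 K_Cr k Ocl a h h' Ox) mulrDr mulrCA.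
Qed.

Hypothesis A_lin : forall a h h', A (a *: h + h') = a *: A h + A h'.
Context (N0 : nat) (xi : forall N, 'I_N -> 'rV[R]_n).
Hypothesis WN_sub : forall N, (N0 <= N)%N ->
  WN Omega K f g mu (@xi N) `<=` rangeA H f g mu.
Hypothesis conv : galerkin_convergent H f g mu N0 (@xi).

Lemma galerkin_uniformly_bounded : exists2 M : R, 0 <= M &
  forall N h, (N0 <= N)%N -> `|galerkin H f g mu (@xi N) (A h)| <= M * `|h|.
Proof.
have [wd cv] := conv.
pose T N h := galerkin H f g mu (@xi N) (A h).
have Tlin N : (N0 <= N)%N ->
    forall a h h', T N (a *: h + h') = a *: T N h + T N h'.
  by move=> N0N a h h'; exact: (galerkin_lin A_lin (WN_sub N0N) (wd N N0N)).
pose F := [set T N | N in [set N | (N0 <= N)%N]].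
have Fb : forall t, F t -> bounded_fun_norm t /\ linear t.
  move=> _ [N N0N <-]; split; last by move=> a h h'; exact: Tlin.
  have [C CP] := galerkin_bounded A_lin (WN_sub N0N) (wd N N0N).
  move=> r; exists (`|C| * r) => h hr.
  apply: le_trans (CP h) _; apply: le_trans (ler_norm _) _.
  by rewrite normrM normr_id ler_wpM2l.
have Fp : pointwise_bounded F.
  move=> h; have Ah : rangeA H f g mu (A h) by exists h.
  have := cv _ Ah; set l := 'pinv_ _ _ _ _ => cvh.
  have [n1 _ n1P] := (cvgrPdist_le _ _).1 cvh 1 ltr01.
  (* From [n1] on, [T N h] is within 1 of its limit [l]; the sum covers the finitely many earlier
     indices. *)
  exists (`|l| + 1 + \sum_(i < n1) `|T i h|) => _ [N N0N <-].
  have S0 : 0 <= \sum_(i < n1) `|T i h| by apply: sumr_ge0.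
  have [n1N|Nn1] := leqP n1 N.
    have le1 : `|l - T N h| <= 1 by exact: n1P.
    have le2 : `|T N h| <= `|l| + `|l - T N h|.
      by have := ler_normD (T N h - l) l; rewrite subrK distrC addrC.
    by rewrite (le_trans le2)// -addrA lerD2l (le_trans le1)// lerDl.
  rewrite (bigD1 (Ordinal Nn1))//= addrCA lerDl addr_ge0 ?addr_ge0//.
  exact: sumr_ge0.
(* The common bound holds on the unit ball and is extended to all [h] by scaling. *)
have [M MP] := Banach_Steinhauss Fb Fp 1.
exists `|M|; first by [].
move=> N h N0N.
have T0 : T N 0 = 0.
  have := Tlin N N0N (-1) 0 0; rewrite scaler0 addr0 scaleN1r addNr => ->.
  by [].
have TZ a u : T N (a *: u) = a *: T N u.
  by have := Tlin N N0N a u 0; rewrite T0 !addr0.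
change (`|T N h| <= `|M| * `|h|).
have [->|h0] := eqVneq h 0.
  by rewrite T0 !normr0 mulr0.
have n0 : 0 < `|h| by rewrite normr_gt0.
have FN : F (T N) by exists N.
have := MP (T N) FN (`|h|^-1 *: h).
rewrite TZ !normrZ normfV normr_id mulVf ?gt_eqF// lexx => /(_ isT) le1.
rewrite -ler_pdivrMr// mulrC; apply: le_trans le1 _; exact: ler_norm.
Qed.

End uniform_bound.

(** * The error estimate *)

Theorem theorem2 (R : realType) (n m : nat)
  (Omega : set 'rV[R]_n) (K : 'rV[R]_n -> 'rV[R]_n -> R) (s : nat)
  (Omega_compact : compact Omega)
  (Omega_sc : simply_connected Omega)
  (Omega_closure : Omega = closure Omega°)
  (K_sym : symmetric_on Omega K)
  (K_pos : strictly_positive_on Omega K)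
  (K_bounded : diag_bounded_on Omega K)
  (s_ge1 : (1 <= s)%N)
  (K_C2s : Ck_on (2 * s) (sqdom Omega) (uncurry_rV K))
  (H : rkhs Omega K)
  (f : 'rV[R]_n -> 'rV[R]_n) (g : 'rV[R]_n -> 'M[R]_(n, m))
  (mu : 'rV[R]_n -> 'rV[R]_m)
  (N0 : nat) (xi : forall N, 'I_N -> 'rV[R]_n)
  (xi_Omega : forall N, (N0 <= N)%N -> forall i, Omega (xi N i))
  (xi_distinct : forall N, (N0 <= N)%N -> injective (xi N))
  (HN_sub : forall N, (N0 <= N)%N -> HN H (xi N) `<=` orthN f g mu)
  (WN_sub : forall N, (N0 <= N)%N ->
     WN Omega K f g mu (xi N) `<=` rangeA H f g mu)
  (b : 'rV[R]_n -> R) (b_W : rangeA H f g mu b)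
  (v : H) (Av_eq_b : opA f g mu v = b)
  (p : 'rV[R]_n -> R) (p_L2 : in_L2 Omega p)
  (v_LKp : forall x, Omega x -> rkhs_fun v x = LK Omega K p x)
  (conv : galerkin_convergent H f g mu N0 xi) :
  exists C1 C2 : R, [/\ 0 < C1, 0 < C2 &
    forall (bdelta : 'rV[R]_n -> R) (N : nat),
    rangeA H f g mu bdelta -> (N0 <= N)%N ->
    let delta := normW H f g mu (b - bdelta) in
    let vNdelta := galerkin H f g mu (xi N) bdelta in
    let err := v - vNdelta in
    let kappa := sup [set Num.sqrt (K x x) | x in Omega] in
    let bound := C1 * delta + C2 * normL2 Omega p *
      sup [set Num.sqrt (K x x -
             ((kvec K (xi N) x)^T *m invmx (gram K (xi N)) *m
              kvec K (xi N) x) 0 0) | x in Omega] in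
    [/\ (normLoo Omega (rkhs_fun err) <= (kappa * `|err|)%:E)%E,
        `|err| <= bound,
        (normLoo Omega (rkhs_fun err) <= bound%:E)%E &
        bound = C1 * delta +
          C2 * sup [set power_fun K (xi N) x | x in Omega] * normL2 Omega p]].
Proof.
have r2 : (2 <= 2 * s)%N by rewrite leq_pmulr.
have A_lin := opA_lin f g mu r2 K_C2s Omega_closure (H := H).
have [M M0 MP] := galerkin_uniformly_bounded A_lin WN_sub conv.
have [Kcont _ _] := K_C2s.
have [c c0 cP] := HN_approx H K_bounded Omega_compact K_sym Kcont K_pos.
pose kappa := sup [set Num.sqrt (K x x) | x in Omega].
have kappa0 : 0 <= kappa.
  apply: sup_image_ge0; first exact: has_ubound_sqrt_diag.
  by move=> x _; exact: sqrtr_ge0.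
have k1 : 0 < 1 + kappa by rewrite ltr_wpDr.
have M1 : 0 < 1 + M by rewrite ltr_wpDr.
have c1 : 0 < 1 + c by rewrite ltr_wpDr.
(* [M] bounds the operators [T], [c] comes from the approximation in [H_N], and the factor with
   [kappa] lets one bound dominate both [|err|] and [kappa * |err|]. The added ones make the
   constants positive. *)
exists ((1 + kappa) * (1 + M)), ((1 + kappa) * ((1 + M) * (1 + c))).
split; [by rewrite mulr_gt0|by rewrite !mulr_gt0|].
move=> bdelta N [w _ wE] N0N delta vNdelta err kappa' bound.
pose T (h : H) := galerkin H f g mu (xi N) (opA f g mu h).
have T_lin a h h' : T (a *: h + h') = a *: T h + T h'.
  exact: (galerkin_lin A_lin (WN_sub N N0N) (conv.1 N N0N)).
have TB h h' : T (h - h') = T h - T h'.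
  by rewrite addrC -scaleN1r T_lin scaleN1r addrC.
have [u Hu vu] :=
  cP p v p_L2 v_LKp N (xi N) (xi_Omega N N0N) (xi_distinct N N0N).
have Tu : T u = u := galerkin_id A_lin (WN_sub N N0N) (conv.1 N N0N) Hu.
pose S := sup [set power_fun K (xi N) x | x in Omega].
have boundE : bound = (1 + kappa) *
    ((1 + M) * (S * (normL2 Omega p * (1 + c))) + (1 + M) * delta).
  by rewrite /bound -/S; ring.
have S0 : 0 <= S.
  apply: sup_image_ge0; last by move=> x _; exact: sqrtr_ge0.
  exact: (has_ubound_power_fun H K_bounded K_sym K_pos
    (xi_Omega N N0N) (xi_distinct N N0N)).
have p0 : 0 <= normL2 Omega p by rewrite /normL2 fine_ge0// Lnorm_ge0.
have Avw : opA f g mu (v - w) = b - bdelta.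
  have := A_lin (-1) w v; rewrite !scaleN1r addrC => ->.
  by rewrite wE Av_eq_b addrC.
(* [T] sees only the image under [A], so [v - w] may be replaced by any [h] with [A h = b - bdelta];
   the infimum over [h] turns [|h|] into [delta]. *)
have Tdelta : `|T (v - w)| <= (1 + M) * delta.
  rewrite mulrC -ler_pdivrMr//; apply: lb_le_inf.
    by exists `|v - w|; exists (v - w); [exact: Avw|].
  move=> _ [h /= hE <-]; rewrite ler_pdivrMr// mulrC.
  have -> : T (v - w) = T h.
    exact: (congr1 (galerkin H f g mu (xi N)) (etrans Avw (esym hE))).
  apply: le_trans (MP N h N0N) _; rewrite ler_wpM2r//.
  by rewrite lerDr.
(* As [T u = u], the terms in [u] cancel and what remains is [v - T v] plus the propagated noise
   [T v - T w]. *)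
have errE : err = ((v - u) - T (v - u)) + T (v - w).
  rewrite /err /vNdelta -wE -/(T w) !TB Tu.
  by rewrite opprB !addrA !subrK.
have err_le : `|err| <=
    (1 + M) * (S * (normL2 Omega p * (1 + c))) + (1 + M) * delta.
  rewrite errE (le_trans (ler_normD _ _))// lerD//.
  apply: (@le_trans _ _ ((1 + M) * `|v - u|)).
    rewrite mulrDl mul1r (le_trans (ler_normB _ _))// lerD2l.
    exact: MP.
  rewrite ler_wpM2l ?(ltW M1)// (le_trans vu)// !ler_wpM2l//.
  by rewrite lerDr.
have kerr : (1 + kappa) * `|err| <= bound by rewrite boundE ler_wpM2l// ltW.
have Loo : (normLoo Omega (rkhs_fun err) <= (kappa' * `|err|)%:E)%E.
  apply: normLoo_le; first by rewrite mulr_ge0.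
  by move=> x Ox; rewrite mulrC; exact: rkhs_fun_le_sup.
split.
- exact: Loo.
- by apply: le_trans kerr; rewrite ler_peMl// lerDl.
- apply: le_trans Loo _; rewrite lee_fin; apply: le_trans kerr.
  by rewrite ler_wpM2r// /kappa' -/kappa lerDr.
- by rewrite boundE -/S; ring.
Qed.
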